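(* Let $\mathcal H$ be a separable Hilbert space, let $F(\cdot)\in R[\mathcal H]$, and suppose that $F(z_0)\in\mathfrak S_p(\mathcal H)$ for some $z_0\in\mathbb C_+$ and some $p\in(0,\infty]$. Then $F(z)\in\mathfrak S_p(\mathcal H)$ for all $z\in\mathbb C_+$.
   Context: $R[\mathcal H]$ is the class of functions $F$ holomorphic on $\mathbb C\setminus\mathbb R$ with values in the bounded operators on $\mathcal H$ such that $\operatorname{Im}F(z)=\frac1{2i}(F(z)-F(z)^* )\ge0$ for $z\in\mathbb C_+$, $\operatorname{Im}F(z)\le0$ for $z\in\mathbb C_-$, and $F(z)^*=F(\bar z)$. $\mathfrak S_p(\mathcal H)$, $0<p<\infty$, is the Schatten-von Neumann class of compact operators whose singular numbers are $p$-summable; $\mathfrak S_\infty(\mathcal H)$ is the ideal of compact operators. *)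

(* Defs.v *)
From mathcomp Require Import all_boot all_order all_algebra.
From mathcomp Require Import all_classical all_reals all_analysis.
From mathcomp Require Export complex.
Import Order.TTheory GRing.Theory Num.Theory.
Import numFieldNormedType.Exports.
Set Implicit Arguments.
Unset Strict Implicit.
Unset Printing Implicit Defensive.
Local Open Scope classical_set_scope.
Local Open Scope ring_scope.
Local Open Scope complex_scope.

Definition separable_space (T : topologicalType) : Prop :=
  exists D : set T, countable D /\ dense D.

(* The inner products of the library are linear in the first argument and
   conjugate-linear in the second one. A Hilbert space is a complete normed
   space whose norm is induced by an inner product. *)
Definition induces_norm (R : realType) (H : normedModType R[i])
    (dot : {dot H for Num.conj}) : Prop :=
  forall x : H, `|x| ^+ 2 = dot x x.

Section Operators.
Variables (R : realType) (H : completeNormedModType R[i]).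
Variable dot : {dot H for Num.conj}.
Implicit Types T S : H -> H.

Definition bounded_op T : Prop :=
  linear T /\ exists M : R[i], forall x : H, `|T x| <= M * `|x|.

(* For bounded T there is exactly one such vector v, by Riesz' theorem;
   the default value 0 is not used. *)
Definition adjoint T : H -> H :=
  fun y => xget 0 [set v | forall x : H, dot (T x) y = dot x v].

(* The order of R[i] is partial: 0 <= w means that w is real and nonnegative,
   so that T >= 0 entails the vanishing of the imaginary part of the form. *)
Definition nonneg_op T : Prop := forall x : H, 0 <= dot (T x) x.

Definition im_op T : H -> H :=
  fun x => (2%:R * 'i)^-1 *: (T x - adjoint T x).

Definition off_real (z : R[i]) : Prop := complex.Im z != 0.

(* Complex differentiability with respect to the operator norm: the estimate
   on all x says that the operator (F (z + h) - F z) / h - D has norm at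
   most e. *)
Definition op_derivable_at (F : R[i] -> H -> H) (z : R[i]) : Prop :=
  exists2 D : H -> H, bounded_op D &
    forall e : R, 0 < e -> exists2 d : R, 0 < d &
      forall h : R[i], h != 0 -> `|h| < d%:C -> forall x : H,
        `|h^-1 *: (F (z + h) x - F z x) - D x| <= e%:C * `|x|.

(* The values of F on the real axis are irrelevant. *)
Definition nevanlinna (F : R[i] -> H -> H) : Prop :=
  [/\ forall z : R[i], off_real z -> bounded_op (F z),
      forall z : R[i], off_real z -> op_derivable_at F z,
      forall z : R[i], 0 < complex.Im z -> nonneg_op (im_op (F z)),
      forall z : R[i], complex.Im z < 0 -> nonneg_op (fun x => - im_op (F z) x)
    & forall z : R[i], off_real z -> adjoint (F z) = F (z^*)].

Definition compact_op T : Prop :=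
  bounded_op T /\ precompact (T @` [set x | `|x| <= 1]).

Definition has_dim (V : set H) (m : nat) : Prop :=
  exists e : 'I_m -> H,
    (forall a : 'I_m -> R[i],
       \sum_(i < m) a i *: e i = 0 -> forall i, a i = 0) /\
    V = [set \sum_(i < m) a i *: e i | a in [set: 'I_m -> R[i]]].

Definition eigenspace_op T (c : R[i]) : set H := [set x | T x = c *: x].

(* The singular numbers of T are the square roots of the eigenvalues of T^* T,
   listed in nonincreasing order and repeated according to multiplicity. The
   sequence ends with zeros if T has finite rank; the multiplicity of the
   value 0 is not otherwise prescribed. Such a sequence s exists and is unique
   for compact T. *)
Definition singular_numbers T (s : nat -> R) : Prop :=
  [/\ forall n, 0 <= s n,
      forall m n, (m <= n)%N -> s n <= s m
    & forall l : R, 0 < l -> exists m : nat,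
        ([set n | s n = l] #= `I_m)%card /\
        has_dim (eigenspace_op (adjoint T \o T) ((l ^+ 2)%:C)) m].

(* Only used for 0 < p. *)
Definition schatten (p : \bar R) T : Prop :=
  compact_op T /\
  match p with
  | r%:E%E => exists s : nat -> R,
      singular_numbers T s /\ cvgn (series (fun n => s n `^ r))
  | +oo%E => True
  | -oo%E => False
  end.

End Operators.

(* Main.v *)
Require Import Defs.
From mathcomp Require Import all_boot all_order all_algebra finmap.
From mathcomp Require Import all_classical all_reals all_analysis.
From mathcomp Require Import ring lra.
Import Order.TTheory GRing.Theory Num.Theory.
Import numFieldNormedType.Exports Normc.
Set Implicit Arguments.
Unset Strict Implicit.
Unset Printing Implicit Defensive.
Local Open Scope classical_set_scope.
Local Open Scope ring_scope.
Local Open Scope complex_scope.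

(** Put T = F(z0) and D = F(z) - F(z0), and let b(x) >= 0 be the imaginary part
    of the form <T x, x>. The whole argument consists in controlling D by b.

    For each vector x the function w |-> <F(w) x, x> is holomorphic on the upper
    half-plane and has nonnegative imaginary part there. The Schwarz-Pick
    inequality bounds the variation of such a function between z0 and z by its
    imaginary part at z0, with a constant C that depends on z and z0 only
    ([harnack]). Therefore |<D x, x>| <= C b(x) for all x, and by polarization
    |<D x, y>| <= C (b(x) + b(y)) ([form_bound]).

    Let V be the span of the first n singular vectors of T. On the orthogonal
    complement of V one has |T x| <= s_n(T) |x|, hence b(x) <= s_n(T) |x|^2.
    If x is orthogonal both to V and to the image of V under the adjoint of D,
    then x and D x are orthogonal to V, and the choice y = D x in the bound for
    the form gives |D x| <= 2 C s_n(T) |x| ([form_bound_mul]). These are 2 n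
    linear conditions on x, so that s_2n(F(z)) <= (1 + 2 C) s_n(T) by the
    principle of Courant and Fischer ([courant_fischer],
    [singular_value_comparison]), and p-summability passes from T to F(z). The
    bound on the form also gives |D x|^2 <= c |T x| |x| ([norm_bound_compact]),
    from which F(z) is compact because T is.

    The singular numbers of a compact operator A are realized by vectors that
    maximize |A x| successively on the orthogonal complements of the preceding
    ones ([exists_extremal], [singular_numbers_exist]); by uniqueness
    ([singular_numbers_unique]) any sequence of singular numbers can be handled
    in this way.

    The Schwarz-Pick inequality is derived for functions that are only assumed
    to be complex differentiable at each point. Goursat's theorem for
    rectangles ([goursat]) provides a primitive G, and the quotients
    (G(z + d) - G(z)) / d have expansions of order two at each point. For
    functions with such expansions the maximum principle ([max_principle]) is
    elementary, since the four values at w + t, w - t, w + i t and w - i t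
    average to the value at w up to o(t^2). It is applied to the function
    g(z)^2 s / (z - c), where g is the Cayley transform of f that vanishes
    at c. *)

(** * The modulus of a complex number and functions of a real variable *)

Section ComplexModulus.
Variable R : realType.
Implicit Types z w : R[i].

Lemma normc_ge0 z : 0 <= normc z.
Proof. by case: z => a b /=; exact: sqrtr_ge0. Qed.

Lemma normr_normc z : `|z| = (normc z)%:C.
Proof. by case: z. Qed.

Lemma sqr_normc_ReIm z : normc z ^+ 2 = complex.Re z ^+ 2 + complex.Im z ^+ 2.
Proof. by case: z => a b /=; rewrite sqr_sqrtr // addr_ge0 ?sqr_ge0. Qed.

Lemma normc_gt0 z : (0 < normc z) = (z != 0).
Proof.
rewrite lt_def normc_ge0 andbT; apply/idP/idP; apply: contra => /eqP h; apply/eqP.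
  by rewrite h normc0.
exact: eq0_normc.
Qed.

Lemma normc_Re z : `|complex.Re z| <= normc z.
Proof. by have := normc_ge_Re z; rewrite normr_normc lecR. Qed.

Lemma normc_Im z : `|complex.Im z| <= normc z.
Proof.
have := normc_Re (- ('i * z)); case: z => a b /=.
by rewrite !(mul0r, mul1r, mulr0, add0r, sub0r, addr0, opprK, subr0) sqrrN addrC.
Qed.

Lemma normc_ReIm z : normc z <= `|complex.Re z| + `|complex.Im z|.
Proof.
rewrite -(@ler_pXn2r _ 2) ?nnegrE ?normc_ge0 ?addr_ge0 ?normr_ge0 //.
rewrite sqr_normc_ReIm sqrrD !real_normK ?num_real // addrAC lerDl.
by rewrite mulrn_wge0 // mulr_ge0 ?normr_ge0.
Qed.

Lemma normc_real (a : R) : normc a%:C = `|a|.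
Proof. by rewrite /= expr0n /= addr0 sqrtr_sqr. Qed.

Lemma normc_i : normc 'i%C = 1 :> R.
Proof. by rewrite /= expr0n expr1n add0r sqrtr1. Qed.

Lemma normcB z w : normc (z - w) <= normc z + normc w.
Proof. by rewrite -(normcN w) le_normcD. Qed.

Lemma normcX z n : normc (z ^+ n) = normc z ^+ n.
Proof. by elim: n => [|n IH]; rewrite ?expr0 ?normc1 // !exprS normcM IH. Qed.

Lemma normc_distC z w : normc (z - w) = normc (w - z).
Proof. by rewrite -normcN opprB. Qed.

End ComplexModulus.

Section RealPrimitive.
Variable R : realType.

(** Continuity is assumed on a half-line only, because the functions to be
    integrated below are restrictions of functions on a half-plane. *)
Lemma primitive_right (p : R -> R) (a b : R) : a < b ->
  (forall x, a < x -> {for x, continuous p}) ->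
  exists P : R -> R, forall x, b < x -> is_derive x 1 P (p x).
Proof.
move=> ab cp.
exists (fun y => \int[lebesgue_measure]_(t in `[b, y]) p t) => x bx.
have xx1 : x < x + 1 by rewrite ltrDl.
have int : lebesgue_measure.-integrable `[b, x + 1] (EFin \o p).
  apply: continuous_compact_integrable; first exact: segment_compact.
  apply: continuous_in_subspaceT => y; rewrite inE /= in_itv /= => /andP[by1 _].
  by apply: cp; apply: lt_le_trans by1.
have [dP P'] := continuous_FTC1_closed xx1 int bx (cp _ (lt_trans ab bx)).
by apply: DeriveDef; [exact: dP|rewrite -derive1E; exact: P'].
Qed.

End RealPrimitive.

Section ComplexDerivative.
Variable R : realType.

(** Complex-valued functions of a real variable are differentiated
    componentwise, which keeps the real theory (primitives, mean values)
    available. *)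
Definition is_cderive (phi : R -> R[i]) (t : R) (d : R[i]) :=
  is_derive t 1 (fun u => complex.Re (phi u)) (complex.Re d) /\
  is_derive t 1 (fun u => complex.Im (phi u)) (complex.Im d).

Lemma is_cderiveB phi psi t d e : is_cderive phi t d -> is_cderive psi t e ->
  is_cderive (fun u => phi u - psi u) t (d - e).
Proof.
move=> [h1 h2] [k1 k2]; split; rewrite raddfB /=.
  have -> : (fun u => complex.Re (phi u - psi u)) =
    (fun u => complex.Re (phi u)) - (fun u => complex.Re (psi u)).
    by apply/funext => u; rewrite raddfB.
  exact: is_deriveB.
have -> : (fun u => complex.Im (phi u - psi u)) =
  (fun u => complex.Im (phi u)) - (fun u => complex.Im (psi u)).
  by apply/funext => u; rewrite raddfB.
exact: is_deriveB.
Qed.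

Lemma is_cderive_quadratic (c0 c1 c2 : R[i]) (t : R) :
  is_cderive (fun u => c0 + c1 * u%:C + c2 * u%:C ^+ 2) t
    (c1 + 2%:R * c2 * t%:C).
Proof.
have quad (a b c : R) : is_derive t 1 (fun u => a + b * u + c * u ^+ 2)
    (b + 2 * c * t).
  apply: is_derive_eq.
  by rewrite /GRing.scale /=; ring.
split.
  have := quad (complex.Re c0) (complex.Re c1) (complex.Re c2).
  congr is_derive; first apply/funext => u.
    by case: c0 c1 c2 => [a1 b1] [a2 b2] [a3 b3] /=; ring.
  by case: c0 c1 c2 => [a1 b1] [a2 b2] [a3 b3] /=; ring.
have := quad (complex.Im c0) (complex.Im c1) (complex.Im c2).
congr is_derive; first apply/funext => u.
  by case: c0 c1 c2 => [a1 b1] [a2 b2] [a3 b3] /=; ring.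
by case: c0 c1 c2 => [a1 b1] [a2 b2] [a3 b3] /=; ring.
Qed.

Lemma real_mean_value (phi d : R -> R) (a b : R) :
  (forall t, (a <= t <= b) || (b <= t <= a) -> is_derive t 1 phi (d t)) ->
  exists2 c, (a <= c <= b) || (b <= c <= a) & phi b - phi a = d c * (b - a).
Proof.
move=> h.
have main (x y : R) : x < y -> (forall t, x <= t <= y -> is_derive t 1 phi (d t)) ->
    exists2 c, x <= c <= y & phi y - phi x = d c * (y - x).
  move=> xy k.
  have [c] : exists2 c, c \in `]x, y[ & phi y - phi x = d c * (y - x).
    apply: MVT => // [t|].
      by rewrite in_itv /= => /andP[xt ty]; apply: k; rewrite !ltW.
    apply: derivable_within_continuous => t; rewrite in_itv /= => xty.
    by have [] := k t xty.
  by rewrite in_itv /= => /andP[xc cy] ->; exists c; rewrite // !ltW.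
case: (ltgtP a b) => [ab|ba|->].
- have [t tab|c cab ->] := main a b ab; first by apply: h; rewrite tab.
  by exists c => //; rewrite cab.
- have [t tab|c cab e] := main b a ba; first by apply: h; rewrite tab orbT.
  exists c; first by rewrite cab orbT.
  by rewrite -opprB e -mulrN opprB.
- by exists b; rewrite ?lexx // !subrr mulr0.
Qed.

(** The mean value theorem applied to the two components; this is where the
    factor 2 comes from. It serves as a bound for integrals, the integral of d
    being expressed as the increment of phi. *)
Lemma cderive_mean_value (phi d : R -> R[i]) (a b B : R) :
  (forall t, (a <= t <= b) || (b <= t <= a) -> is_cderive phi t (d t)) ->
  (forall t, (a <= t <= b) || (b <= t <= a) -> normc (d t) <= B) ->
  normc (phi b - phi a) <= 2 * B * `|b - a|.
Proof.
move=> h hB; apply: le_trans (normc_ReIm _) _.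
have [c cab e] := real_mean_value (fun t tab => (h t tab).1).
have [c' cab' e'] := real_mean_value (fun t tab => (h t tab).2).
rewrite !raddfB /= e e' !normrM -mulrDl ler_wpM2r ?normr_ge0 //.
have := le_trans (normc_Re (d c)) (hB _ cab).
have := le_trans (normc_Im (d c')) (hB _ cab').
lra.
Qed.

End ComplexDerivative.

(** * Goursat's theorem for rectangles *)

Section Goursat.
Variable R : realType.

Definition cdiff (f : R[i] -> R[i]) (z D : R[i]) :=
  forall e : R, 0 < e -> exists2 d : R, 0 < d &
    forall h, normc h < d -> normc (f (z + h) - f z - D * h) <= e * normc h.

Variables (f : R[i] -> R[i]) (X Y : R -> R -> R[i]) (a b : R).
Hypothesis hX : forall x y, a < x -> b < y -> is_cderive (X y) x (f (x +i* y)).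
Hypothesis hY : forall x y, a < x -> b < y -> is_cderive (Y x) y (f (x +i* y)).
Hypothesis hf : forall z, a < complex.Re z -> b < complex.Im z ->
  exists D, cdiff f z D.

Let q (p D z : R[i]) := f p * z + D / 2%:R * (z - p) ^+ 2.

Lemma complexDi (x y : R) : x +i* y = x%:C + 'i * y%:C.
Proof. by simpc. Qed.

Let ii : 'i * 'i = -1 :> R[i].
Proof. by rewrite -expr2 sqr_i. Qed.

(** Here X y is a primitive of f along the horizontal line of height y, so
    X y x2 - X y x1 is the integral of f over a segment. It is compared with
    the increment of q, the quadratic polynomial whose derivative is the affine
    approximation of f at p. *)
Lemma primitive_x_approx p D : cdiff f p D ->
  forall e, 0 < e -> exists2 d : R, 0 < d & forall x1 x2 y r,
    a < x1 -> a < x2 -> b < y -> r < d ->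
    `|x1 - complex.Re p| + `|y - complex.Im p| <= r ->
    `|x2 - complex.Re p| + `|y - complex.Im p| <= r ->
    normc (X y x2 - X y x1 - (q p D (x2 +i* y) - q p D (x1 +i* y)))
      <= 2 * (e * r) * `|x2 - x1|.
Proof.
move=> hD e e0; have [d d0 hd] := hD e e0; exists d => // x1 x2 y r ax1 ax2 by_ rd h1 h2.
pose w := 'i * y%:C - p.
pose s u := (f p * 'i * y%:C + D / 2%:R * w ^+ 2) + (f p + D * w) * u%:C +
  D / 2%:R * u%:C ^+ 2.
have sE u : q p D (u +i* y) = s u.
  by rewrite /q /s /w complexDi; field.
have btw u : (x1 <= u <= x2) || (x2 <= u <= x1) ->
    a < u /\ `|u - complex.Re p| + `|y - complex.Im p| <= r.
  move=> hu; split; first by case/orP: hu => /andP[]; lra.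
  move: h1 h2; rewrite -!lerBrDr !ler_norml => /andP[? ?] /andP[? ?].
  by case/orP: hu => /andP[? ?]; apply/andP; split; lra.
rewrite !sE; have -> : X y x2 - X y x1 - (s x2 - s x1) =
   (X y x2 - s x2) - (X y x1 - s x1) by ring.
apply: (@cderive_mean_value _ (fun u => X y u - s u)
  (fun u => f (u +i* y) - ((f p + D * w) + 2%:R * (D / 2%:R) * u%:C))) => u /btw[au hu].
  by apply: is_cderiveB; [exact: hX|exact: is_cderive_quadratic].
have -> : f (u +i* y) - ((f p + D * w) + 2%:R * (D / 2%:R) * u%:C) =
   f (p + (u +i* y - p)) - f p - D * (u +i* y - p).
  by rewrite (addrC p) subrK /w complexDi; field.
have hn : normc (u +i* y - p) <= r.
  apply: le_trans (normc_ReIm _) _; apply: le_trans hu.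
  by rewrite !raddfB.
apply: le_trans (hd _ (le_lt_trans hn rd)) _.
by rewrite ler_wpM2l // ltW.
Qed.

Lemma primitive_y_approx p D : cdiff f p D ->
  forall e, 0 < e -> exists2 d : R, 0 < d & forall y1 y2 x r,
    b < y1 -> b < y2 -> a < x -> r < d ->
    `|x - complex.Re p| + `|y1 - complex.Im p| <= r ->
    `|x - complex.Re p| + `|y2 - complex.Im p| <= r ->
    normc ('i * (Y x y2 - Y x y1) - (q p D (x +i* y2) - q p D (x +i* y1)))
      <= 2 * (e * r) * `|y2 - y1|.
Proof.
move=> hD e e0; have [d d0 hd] := hD e e0; exists d => // y1 y2 x r by1 by2 ax rd h1 h2.
pose w := x%:C - p.
pose s u := (- 'i * (f p * x%:C + D / 2%:R * w ^+ 2)) + (f p + D * w) * u%:C +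
  ('i * (D / 2%:R)) * u%:C ^+ 2.
have sE u : q p D (x +i* u) = 'i * s u.
  rewrite /q /s /w complexDi !mulrDr !mulrA mulrN ii.
  transitivity (f p * (x%:C + 'i * u%:C) + D / 2%:R * ((x%:C - p) ^+ 2 +
    2%:R * 'i * u%:C * (x%:C - p) + ('i * 'i) * u%:C ^+ 2)).
    by field.
  by rewrite ii; field.
have btw u : (y1 <= u <= y2) || (y2 <= u <= y1) ->
    b < u /\ `|x - complex.Re p| + `|u - complex.Im p| <= r.
  move=> hu; split; first by case/orP: hu => /andP[]; lra.
  move: h1 h2; rewrite -!lerBrDl !ler_norml => /andP[? ?] /andP[? ?].
  by case/orP: hu => /andP[? ?]; apply/andP; split; lra.
rewrite !sE; have -> : 'i * (Y x y2 - Y x y1) - ('i * s y2 - 'i * s y1) =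
   'i * ((Y x y2 - s y2) - (Y x y1 - s y1)) by ring.
rewrite normcM normc_i mul1r.
apply: (@cderive_mean_value _ (fun u => Y x u - s u)
  (fun u => f (x +i* u) - ((f p + D * w) + 2%:R * ('i * (D / 2%:R)) * u%:C))) => u /btw[au hu].
  by apply: is_cderiveB; [exact: hY|exact: is_cderive_quadratic].
have -> : f (x +i* u) - ((f p + D * w) + 2%:R * ('i * (D / 2%:R)) * u%:C) =
   f (p + (x +i* u - p)) - f p - D * (x +i* u - p).
  by rewrite (addrC p) subrK /w complexDi; field.
have hn : normc (x +i* u - p) <= r.
  apply: le_trans (normc_ReIm _) _; apply: le_trans hu.
  by rewrite !raddfB.
apply: le_trans (hd _ (le_lt_trans hn rd)) _.
by rewrite ler_wpM2l // ltW.
Qed.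

(** The integral of f(z) dz along the boundary of the rectangle with lower
    left corner x + i y and sides l and m. Primitives stand for integrals, so
    that additivity under subdivision is an identity of rings. *)
Definition circulation (x y l m : R) : R[i] :=
  (X y (x + l) - X y x) + 'i * (Y (x + l) (y + m) - Y (x + l) y)
  - (X (y + m) (x + l) - X (y + m) x) - 'i * (Y x (y + m) - Y x y).

(** The increments of the polynomial q cancel along a closed contour, so only
    the error terms of the four sides remain, each of which is small compared
    with the square of the diameter. *)
Lemma circulation_local p D : cdiff f p D -> 
  forall e, 0 < e -> exists2 d : R, 0 < d & forall x y l m,
    a < x -> b < y -> x <= complex.Re p <= x + l -> y <= complex.Im p <= y + m ->
    l + m < d -> normc (circulation x y l m) <= e * (l + m) ^+ 2.
Proof.
move=> hD e e0.
have e4 : 0 < e / 4 by rewrite divr_gt0.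
have [d1 d10 h1] := primitive_x_approx hD e4.
have [d2 d20 h2] := primitive_y_approx hD e4.
exists (Num.min d1 d2); first by rewrite lt_min d10.
move=> x y l m ax by_ /andP[xp px] /andP[yp py]; rewrite lt_min => /andP[lm1 lm2].
have l0 : 0 <= l by lra.
have m0 : 0 <= m by lra.
have axl : a < x + l by lra.
have bym : b < y + m by lra.
have n1 : `|x - complex.Re p| <= l by rewrite ler_norml; apply/andP; split; lra.
have n2 : `|x + l - complex.Re p| <= l by rewrite ler_norml; apply/andP; split; lra.
have n3 : `|y - complex.Im p| <= m by rewrite ler_norml; apply/andP; split; lra.
have n4 : `|y + m - complex.Im p| <= m by rewrite ler_norml; apply/andP; split; lra.
have k1 := h1 x (x + l) y (l + m) ax axl by_ lm1 (lerD n1 n3) (lerD n2 n3).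
have k2 := h1 x (x + l) (y + m) (l + m) ax axl bym lm1 (lerD n1 n4) (lerD n2 n4).
have k3 := h2 y (y + m) x (l + m) by_ bym ax lm2 (lerD n1 n3) (lerD n1 n4).
have k4 := h2 y (y + m) (x + l) (l + m) by_ bym axl lm2 (lerD n2 n3) (lerD n2 n4).
set A1 := (X in normc X) in k1; set A2 := (X in normc X) in k2.
set A3 := (X in normc X) in k3; set A4 := (X in normc X) in k4.
have -> : circulation x y l m = (A1 + A4) - (A2 + A3).
  by rewrite /circulation /A1 /A2 /A3 /A4; ring.
have t1 := normcB (A1 + A4) (A2 + A3).
have t2 := le_normcD A1 A4.
have t3 := le_normcD A2 A3.
move: k1 k2 k3 k4; rewrite [x + l]addrC [y + m]addrC !addrK !ger0_norm // => k1 k2 k3 k4.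
apply: le_trans t1 _.
have -> : e * (l + m) ^+ 2 = 2 * (e / 4 * (l + m)) * l + 2 * (e / 4 * (l + m)) * m +
   (2 * (e / 4 * (l + m)) * l + 2 * (e / 4 * (l + m)) * m) by field.
by apply: lerD; [apply: le_trans t2 _; exact: lerD|apply: le_trans t3 _; exact: lerD].
Qed.

(** The circulation is the sum of those of the four quarters, so one of the
    quarters carries at least a fourth of it. *)
Lemma circulation_quarter x y l m : 0 <= l -> 0 <= m -> exists c : R * R,
  [/\ x <= c.1 <= x + l / 2, y <= c.2 <= y + m / 2 &
   normc (circulation x y l m)
     <= 4 * normc (circulation c.1 c.2 (l / 2) (m / 2))].
Proof.
move=> l0 m0; set I := fun x y => normc (circulation x y (l / 2) (m / 2)).
have hx : x + l / 2 + l / 2 = x + l by field.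
have hy : y + m / 2 + m / 2 = y + m by field.
have sum : normc (circulation x y l m) <=
   I x y + I (x + l / 2) y + I x (y + m / 2) + I (x + l / 2) (y + m / 2).
  have -> : circulation x y l m =
    circulation x y (l / 2) (m / 2) + circulation (x + l / 2) y (l / 2) (m / 2) +
    circulation x (y + m / 2) (l / 2) (m / 2) +
    circulation (x + l / 2) (y + m / 2) (l / 2) (m / 2).
    by rewrite /circulation !hx !hy; ring.
  apply: le_trans (le_normcD _ _) _; rewrite lerD2r.
  apply: le_trans (le_normcD _ _) _; rewrite lerD2r.
  exact: le_normcD.
have l2 : 0 <= l / 2 by rewrite divr_ge0.
have m2 : 0 <= m / 2 by rewrite divr_ge0.
case: (lerP (normc (circulation x y l m)) (4 * I x y)) => [|s1].
  by exists (x, y); rewrite /= !lexx !lerDl l2 m2.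
case: (lerP (normc (circulation x y l m)) (4 * I (x + l / 2) y)) => [|s2].
  by exists (x + l / 2, y); rewrite /= !lexx !lerDl l2 m2.
case: (lerP (normc (circulation x y l m)) (4 * I x (y + m / 2))) => [|s3].
  by exists (x, y + m / 2); rewrite /= !lexx !lerDl l2 m2.
exists (x + l / 2, y + m / 2); rewrite /= !lexx !lerDl l2 m2; split=> //.
by move: sum s1 s2 s3; rewrite /I; lra.
Qed.

Lemma nested_halves (u : nat -> R) (l : R) : 0 <= l ->
  (forall n, u n <= u n.+1 <= u n + l / 2 ^+ n / 2) ->
  exists p, forall n, u n <= p <= u n + l / 2 ^+ n.
Proof.
move=> l0 hu.
have pos n : (0 : R) < 2 ^+ n by rewrite exprn_gt0.
have mono n k : u n <= u (n + k)%N.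
  elim: k => [|k IH]; first by rewrite addn0.
  by rewrite addnS; apply: le_trans IH _; case/andP: (hu (n + k)%N).
have up n k : u (n + k)%N + l / 2 ^+ (n + k) <= u n + l / 2 ^+ n.
  elim: k => [|k IH]; first by rewrite addn0.
  rewrite addnS; apply: le_trans IH.
  have /andP[_ h] := hu (n + k)%N.
  have -> : l / 2 ^+ (n + k).+1 = l / 2 ^+ (n + k) / 2.
    by rewrite exprS invfM mulrA mulrAC.
  lra.
have ub n : ubound (range u) (u n + l / 2 ^+ n).
  move=> _ [m _ <-]; apply: (@le_trans _ _ (u (n + m)%N)).
    by rewrite addnC.
  apply: le_trans (up n m); rewrite lerDl divr_ge0 // ltW //.
exists (sup (range u)) => n; apply/andP; split.
  by apply: ub_le_sup; [exists (u 0%N + l / 2 ^+ 0); exact: ub|exists n].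
by apply: ge_sup; [exists (u 0%N), 0%N|exact: ub].
Qed.

(** The classical bisection: the chosen quarters shrink to a point p, where
    [circulation_local] bounds the circulation of the n-th rectangle by an
    arbitrarily small multiple of 4^-n. *)
Lemma goursat x y l m : a < x -> b < y -> 0 <= l -> 0 <= m ->
  circulation x y l m = 0.
Proof.
move=> ax by_ l0 m0.
pose P (s : nat * (R * R)) (c : R * R) :=
  [/\ s.2.1 <= c.1 <= s.2.1 + l / 2 ^+ s.1 / 2,
      s.2.2 <= c.2 <= s.2.2 + m / 2 ^+ s.1 / 2 &
   normc (circulation s.2.1 s.2.2 (l / 2 ^+ s.1) (m / 2 ^+ s.1)) <=
   4 * normc (circulation c.1 c.2 (l / 2 ^+ s.1 / 2) (m / 2 ^+ s.1 / 2))].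
have pos n : (0 : R) < 2 ^+ n by rewrite exprn_gt0.
have /choice[g hg] : forall s, exists c, P s c.
  move=> [n [x' y']]; apply: circulation_quarter.
    by rewrite divr_ge0 // ltW.
  by rewrite divr_ge0 // ltW.
pose c := fix c n := if n is k.+1 then g (k, c k) else (x, y).
have half (t : R) n : t / 2 ^+ n / 2 = t / 2 ^+ n.+1.
  by rewrite exprS invfM [RHS]mulrA mulrAC.
have bound n : normc (circulation x y l m) <=
    4 ^+ n * normc (circulation (c n).1 (c n).2 (l / 2 ^+ n) (m / 2 ^+ n)).
  elim: n => [|n IH]; first by rewrite !expr0 !divr1 mul1r.
  apply: le_trans IH _; have [_ _] := hg (n, c n).
  by rewrite /= !half [4 ^+ n.+1]exprSr -mulrA => h; rewrite ler_pM2l // exprn_gt0.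
have [px hpx] : exists p, forall n, (c n).1 <= p <= (c n).1 + l / 2 ^+ n.
  by apply: nested_halves => // n; have [] := hg (n, c n).
have [py hpy] : exists p, forall n, (c n).2 <= p <= (c n).2 + m / 2 ^+ n.
  by apply: nested_halves => // n; have [] := hg (n, c n).
have ge n : x <= (c n).1 /\ y <= (c n).2.
  elim: n => [|n [IH1 IH2]]; first by rewrite /= !lexx.
  have [/= /andP[k1 _] /andP[k2 _] _] := hg (n, c n).
  by split; [exact: le_trans k1|exact: le_trans k2].
have apx : a < px by have /andP[/= ? _] := hpx 0%N; lra.
have bpy : b < py by have /andP[/= ? _] := hpy 0%N; lra.
have [D hD] := @hf (px +i* py) apx bpy.
apply: eq0_normc; apply/eqP; rewrite eq_le normc_ge0 andbT.
apply/ler_addgt0Pr => e e0; rewrite add0r.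
have lm1 : 0 < (l + m + 1) ^+ 2 by rewrite exprn_gt0 // ltr_wpDl // addr_ge0.
have [d d0 hd] := circulation_local hD (divr_gt0 e0 lm1).
have [n hn] : exists n : nat, (l + m) / 2 ^+ n < d.
  exists (Num.trunc ((l + m) / d)).+1.
  rewrite ltr_pdivrMr // mulrC -ltr_pdivrMr //.
  have /andP[_ h] : (Num.trunc ((l + m) / d))%:R <= (l + m) / d < (Num.trunc ((l + m) / d)).+1%:R.
    by apply: truncn_itv; rewrite divr_ge0 ?addr_ge0 // ltW.
  apply: lt_trans h _; rewrite -natrX ltr_nat; exact: ltn_expl.
have [g1 g2] := ge n.
have := hd _ _ (l / 2 ^+ n) (m / 2 ^+ n) (lt_le_trans ax g1) (lt_le_trans by_ g2)
  (hpx n) (hpy n).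
rewrite -mulrDl => /(_ hn) h.
apply: le_trans (bound n) _.
have p4 : (0 : R) < 4 ^+ n by rewrite exprn_gt0.
apply: le_trans (_ : 4 ^+ n * (e / (l + m + 1) ^+ 2 * ((l + m) / 2 ^+ n) ^+ 2) <= _).
  by rewrite ler_pM2l.
have -> : ((l + m) / 2 ^+ n) ^+ 2 = (l + m) ^+ 2 / 4 ^+ n.
  have four : (2 : R) ^+ 2 = 4 by ring.
  by rewrite expr_div_n -exprM mulnC exprM four.
have -> : 4 ^+ n * (e / (l + m + 1) ^+ 2 * ((l + m) ^+ 2 / 4 ^+ n)) =
  e * ((l + m) ^+ 2 / (l + m + 1) ^+ 2).
  by field; rewrite !gt_eqF ?ltr_wpDl ?addr_ge0.
rewrite ler_piMr ?(ltW e0) // ler_pdivrMr // mul1r.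
by rewrite lerXn2r ?nnegrE ?addr_ge0 // lerDl.
Qed.

End Goursat.

(** * Primitives of holomorphic functions *)

Section Primitive.
Variable R : realType.
Implicit Types f : R[i] -> R[i].

Lemma cdiff_continuous f z D : cdiff f z D -> forall e, 0 < e ->
  exists2 d : R, 0 < d & forall h, normc h < d -> normc (f (z + h) - f z) < e.
Proof.
move=> hD e e0; have [d d0 hd] := hD 1 ltr01.
have c0 : 0 < 1 + normc D by rewrite ltr_pwDl ?normc_ge0.
exists (Num.min d (e / (1 + normc D))); first by rewrite lt_min d0 divr_gt0.
move=> h; rewrite lt_min ltr_pdivlMr // => /andP[hd1 hd2].
rewrite -(subrK (D * h) (f (z + h) - f z)).
apply: le_lt_trans (le_normcD _ _) _.
have := hd _ hd1; rewrite normcM; move: hd2; lra.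
Qed.

Lemma cdiff_horizontal f x y D : cdiff f (x +i* y) D ->
  {for x, continuous (fun u => complex.Re (f (u +i* y)))} /\
  {for x, continuous (fun u => complex.Im (f (u +i* y)))}.
Proof.
move=> /cdiff_continuous hc.
suff H e : 0 < e -> \forall u \near x, normc (f (u +i* y) - f (x +i* y)) < e.
  split; apply/cvgrPdist_lt => e e0; near=> u.
    rewrite -raddfB /=; apply: le_lt_trans (normc_Re _) _.
    by rewrite normc_distC; near: u; exact: H.
  rewrite -raddfB /=; apply: le_lt_trans (normc_Im _) _.
  by rewrite normc_distC; near: u; exact: H.
move=> e0; have [d d0 hd] := hc e e0.
near=> u.
have -> : u +i* y = x +i* y + (u - x)%:C by simpc; rewrite addrC subrK.
apply: hd; rewrite normc_real distrC.
near: u; apply: (@cvgr_dist_lt _ _ _ (nbhs x)) => //; exact: cvg_id.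
Unshelve. all: by end_near. Qed.

Lemma cdiff_vertical f x y D : cdiff f (x +i* y) D ->
  {for y, continuous (fun u => complex.Re (f (x +i* u)))} /\
  {for y, continuous (fun u => complex.Im (f (x +i* u)))}.
Proof.
move=> /cdiff_continuous hc.
suff H e : 0 < e -> \forall u \near y, normc (f (x +i* u) - f (x +i* y)) < e.
  split; apply/cvgrPdist_lt => e e0; near=> u.
    rewrite -raddfB /=; apply: le_lt_trans (normc_Re _) _.
    by rewrite normc_distC; near: u; exact: H.
  rewrite -raddfB /=; apply: le_lt_trans (normc_Im _) _.
  by rewrite normc_distC; near: u; exact: H.
move=> e0; have [d d0 hd] := hc e e0.
near=> u.
have -> : x +i* u = x +i* y + 'i * (u - y)%:C by simpc; rewrite addrC subrK.
apply: hd; rewrite normcM normc_i mul1r normc_real distrC.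
near: u; apply: (@cvgr_dist_lt _ _ _ (nbhs y)) => //; exact: cvg_id.
Unshelve. all: by end_near. Qed.

(** The form of Goursat's theorem needed for primitives: the two L-shaped paths
    between opposite corners have the same integral, whatever the relative
    position of the corners. *)
Lemma goursat_rectangle f (X Y : R -> R -> R[i]) (a b : R) :
  (forall x y, a < x -> b < y -> is_cderive (X y) x (f (x +i* y))) ->
  (forall x y, a < x -> b < y -> is_cderive (Y x) y (f (x +i* y))) ->
  (forall z, a < complex.Re z -> b < complex.Im z -> exists D, cdiff f z D) ->
  forall x1 x2 y1 y2, a < x1 -> a < x2 -> b < y1 -> b < y2 ->
  X y1 x2 - X y1 x1 + 'i * (Y x2 y2 - Y x2 y1) =
  'i * (Y x1 y2 - Y x1 y1) + (X y2 x2 - X y2 x1).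
Proof.
move=> hX hY hf x1 x2 y1 y2.
have H x1' x2' y1' y2' : x1' <= x2' -> y1' <= y2' -> a < x1' -> b < y1' ->
    X y1' x2' - X y1' x1' + 'i * (Y x2' y2' - Y x2' y1') =
    'i * (Y x1' y2' - Y x1' y1') + (X y2' x2' - X y2' x1').
  move=> hx hy ax by_.
  have := goursat hX hY hf ax by_ (_ : 0 <= x2' - x1') (_ : 0 <= y2' - y1').
  rewrite !subr_ge0 /circulation ![_ + (_ - _)]addrC !subrK => /(_ hx hy) e.
  by apply/eqP; rewrite -subr_eq0 -e; apply/eqP; ring.
have fin (p q r s : R[i]) : p = q -> r - s = p - q -> r = s.
  by move=> -> /eqP; rewrite subrr subr_eq0 => /eqP.
move=> ax1 ax2 by1 by2.
case: (leP x1 x2) => hx; case: (leP y1 y2) => hy; first exact: H.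
- by apply: (fin _ _ _ _ (esym (H x1 x2 y2 y1 hx (ltW hy) ax1 by2))); ring.
- by apply: (fin _ _ _ _ (esym (H x2 x1 y1 y2 (ltW hx) hy ax2 by1))); ring.
- by apply: (fin _ _ _ _ (H x2 x1 y2 y1 (ltW hx) (ltW hy) ax2 by2)); ring.
Qed.

Lemma cprimitive_right (u : R -> R[i]) (a b : R) : a < b ->
  (forall x, a < x -> {for x, continuous (fun t => complex.Re (u t))} /\
                      {for x, continuous (fun t => complex.Im (u t))}) ->
  exists P : R -> R[i], forall x, b < x -> is_cderive P x (u x).
Proof.
move=> ab cu.
have [P1 h1] := primitive_right ab (fun x ax => (cu x ax).1).
have [P2 h2] := primitive_right ab (fun x ax => (cu x ax).2).
by exists (fun t => P1 t +i* P2 t) => x bx; split; [exact: h1|exact: h2].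
Qed.

(** G is the integral along an L-shaped path from a base point. Its increments
    can be computed along any other such path, which yields an expansion of
    order two with first-order coefficient f. The second property, monotonicity
    of the imaginary part along horizontal lines, makes the quotients
    (G(z + d) - G(z)) / d inherit a nonnegative imaginary part from f. *)
Lemma holomorphic_primitive f (a b a' b' : R) : a < a' -> b < b' ->
  (forall z, a < complex.Re z -> b < complex.Im z -> exists D, cdiff f z D) ->
  exists G : R[i] -> R[i],
  (forall z, a' < complex.Re z -> b' < complex.Im z -> exists D : R[i],
     forall e : R, 0 < e -> exists2 d : R, 0 < d & forall k, normc k < d ->
     normc (G (z + k) - G z - f z * k - D * k ^+ 2) <= e * normc k ^+ 2) /\
  ((forall z, a' < complex.Re z -> b' < complex.Im z -> 0 <= complex.Im (f z)) ->
   forall z (t : R), a' < complex.Re z -> b' < complex.Im z -> 0 <= t ->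
   0 <= complex.Im (G (z + t%:C) - G z)).
Proof.
move=> aa' bb' hf.
have /choice[X hX] : forall y, exists P : R -> R[i], forall x, a' < x -> b' < y ->
    is_cderive P x (f (x +i* y)).
  move=> y; case: (ltP b' y) => b'y; last by exists (fun=> 0).
  have [|P hP] := @cprimitive_right (fun x => f (x +i* y)) a a' aa'; last first.
    by exists P => x ax _; exact: hP.
  move=> x ax; have [|D hD] := hf (x +i* y) ax; first exact: lt_trans b'y.
  exact: cdiff_horizontal hD.
have /choice[Y hY] : forall x, exists P : R -> R[i], forall y, a' < x -> b' < y ->
    is_cderive P y (f (x +i* y)).
  move=> x; case: (ltP a' x) => a'x; last by exists (fun=> 0).
  have [|P hP] := @cprimitive_right (fun y => f (x +i* y)) b b' bb'; last first.
    by exists P => y _ by_; exact: hP.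
  move=> y by_; have [|D hD] := hf (x +i* y) _ by_; first exact: lt_trans a'x.
  exact: cdiff_vertical hD.
have {}hX x y ax by_ := hX y x ax by_.
have hf' z : a' < complex.Re z -> b' < complex.Im z -> exists D, cdiff f z D.
  by move=> az bz; apply: hf; [exact: lt_trans az|exact: lt_trans bz].
pose x0 := a' + 1; pose y0 := b' + 1.
have ax0 : a' < x0 by rewrite ltrDl.
have by0 : b' < y0 by rewrite ltrDl.
pose G z := X y0 (complex.Re z) - X y0 x0 +
  'i * (Y (complex.Re z) (complex.Im z) - Y (complex.Re z) y0).
have GE x y x' y' : a' < x -> b' < y -> a' < x' -> b' < y' ->
    G (x' +i* y') - G (x +i* y) = (X y x' - X y x) + 'i * (Y x' y' - Y x' y).
  move=> ax by_ ax' by'; have /eqP := goursat_rectangle hX hY hf' ax ax' by0 by_.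
  rewrite -subr_eq0 => /eqP e; apply/eqP; rewrite -subr_eq0 -e /G /=; apply/eqP; ring.
exists G; split; last first.
  move=> fpos [x y] t /= ax by_ t0.
  have -> : (x +i* y + t%:C) = (x + t) +i* y by simpc.
  rewrite GE //; last by rewrite ltr_wpDr.
  rewrite subrr mulr0 addr0 raddfB /=.
  have btw s : (x <= s <= x + t) || (x + t <= s <= x) -> a' < s.
    by case/orP => /andP[]; lra.
  have [|c cx ->] := @real_mean_value _ (fun u => complex.Im (X y u))
    (fun u => complex.Im (f (u +i* y))) x (x + t).
    by move=> s /btw as_; have [_] := hX s y as_ by_.
  by rewrite [x + t]addrC addrK mulr_ge0 // fpos //= (btw c).
move=> [x y] /= ax by_; have [D hD] := hf' (x +i* y) ax by_.
exists (D / 2%:R) => e e0.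
have e8 : 0 < e / 8 by rewrite divr_gt0.
have [d1 d10 h1] := primitive_x_approx hX hD e8.
have [d2 d20 h2] := primitive_y_approx hY hD e8.
exists (Num.min (Num.min (d1 / 2) (d2 / 2)) (Num.min (x - a') (y - b'))).
  by rewrite !lt_min !divr_gt0 //= !subr_gt0 ax.
move=> [k1 k2]; set k := k1 +i* k2; rewrite !lt_min.
move=> /andP[/andP[kd1 kd2] /andP[kx ky]].
have n1 : `|k1| <= normc k := normc_Re k.
have n2 : `|k2| <= normc k := normc_Im k.
have ax' : a' < x + k1.
  by move: (le_lt_trans n1 kx); rewrite ltr_norml => /andP[]; lra.
have by' : b' < y + k2.
  by move: (le_lt_trans n2 ky); rewrite ltr_norml => /andP[]; lra.
have -> : x +i* y + k = (x + k1) +i* (y + k2) by rewrite /k; simpc.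
rewrite GE //.
have r1 : 2 * normc k < d1 by lra.
have r2 : 2 * normc k < d2 by lra.
have k0 := normc_ge0 k.
have xk : x + k1 - x = k1 by ring.
have yk : y + k2 - y = k2 by ring.
have z1 : `|x - x| + `|y - y| <= 2 * normc k by rewrite !subrr normr0; lra.
have z2 : `|x + k1 - x| + `|y - y| <= 2 * normc k.
  by rewrite xk subrr normr0; lra.
have z3 : `|x + k1 - x| + `|y + k2 - y| <= 2 * normc k by rewrite xk yk; lra.
have {}h1 := h1 x (x + k1) y (2 * normc k) ax ax' by_ r1 z1 z2; rewrite xk in h1.
have {}h2 := h2 y (y + k2) (x + k1) (2 * normc k) by_ by' ax' r2 z2 z3; rewrite yk in h2.
have eq_ : X y (x + k1) - X y x + 'i * (Y (x + k1) (y + k2) - Y (x + k1) y)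
   - f (x +i* y) * k - D / 2%:R * k ^+ 2 =
  (X y (x + k1) - X y x - (f (x +i* y) * ((x + k1) +i* y) + D / 2%:R * ((x + k1) +i* y - (x +i* y)) ^+ 2
     - (f (x +i* y) * (x +i* y) + D / 2%:R * (x +i* y - (x +i* y)) ^+ 2)))
  + ('i * (Y (x + k1) (y + k2) - Y (x + k1) y)
   - (f (x +i* y) * ((x + k1) +i* (y + k2)) + D / 2%:R * ((x + k1) +i* (y + k2) - (x +i* y)) ^+ 2 -
      (f (x +i* y) * ((x + k1) +i* y) + D / 2%:R * ((x + k1) +i* y - (x +i* y)) ^+ 2))).
  have -> : (x + k1) +i* (y + k2) = (x +i* y) + k by rewrite /k; simpc.
  ring.
rewrite eq_; apply: le_trans (le_normcD _ _) _; apply: le_trans (lerD h1 h2) _.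
rewrite expr2.
have b1 : `|k1| * normc k <= normc k * normc k by rewrite ler_wpM2r.
have b2 : `|k2| * normc k <= normc k * normc k by rewrite ler_wpM2r.
have -> : 2 * (e / 8 * (2 * normc k)) * `|k1| + 2 * (e / 8 * (2 * normc k)) * `|k2| =
  e * ((`|k1| * normc k + `|k2| * normc k) / 2) by field.
by apply: ler_wpM2l; [exact: ltW|move: b1 b2; lra].
Qed.

End Primitive.

(** * Second-order expansions *)

Section Jets.
Variable C : numFieldType.
Implicit Types (f g : C -> C) (w : C).

(** The filter along which the remainders of the expansions below have
    limits. *)
Definition near0 : set_system C := nbhs (0 : C).

Global Instance near0_filter : ProperFilter near0 := nbhs_pfilter _.

Lemma cvg_near0 : k @[k --> near0] --> (0 : C).
Proof. exact: cvg_id. Qed.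

Lemma sqr_cvg0 : k ^+ 2 @[k --> near0] --> (0 : C) ^+ 2.
Proof. exact: (cvgM cvg_near0 cvg_near0). Qed.

(** An expansion of order two in the sense of Peano. The remainder is written
    as eta(k) k^2 with eta continuous at 0, which reduces the stability under
    algebraic operations to rules for limits. *)
Definition jet2 f w := exists a0 a1 : C, exists2 eta : C -> C,
  eta k @[k --> near0] --> eta 0 &
  \forall k \near near0, f (w + k) = a0 + a1 * k + eta k * k ^+ 2.

Lemma jet2_cst a w : jet2 (fun=> a) w.
Proof.
exists a, 0, (fun=> 0); first by exact: cvg_cst.
by near=> k; rewrite !mul0r !addr0.
Unshelve. all: by end_near. Qed.

Lemma jet2_id w : jet2 (fun z => z) w.
Proof.
exists w, 1, (fun=> 0); first by exact: cvg_cst.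
by near=> k; rewrite !mul0r addr0 mul1r.
Unshelve. all: by end_near. Qed.

Lemma jet2D f g w : jet2 f w -> jet2 g w -> jet2 (fun z => f z + g z) w.
Proof.
move=> [a0 [a1 [s cs hs]]] [b0 [b1 [t ct ht]]].
exists (a0 + b0), (a1 + b1), (fun k => s k + t k); first by apply: cvgD.
by apply: filterS2 hs ht => k -> ->; ring.
Qed.

Lemma jet2M f g w : jet2 f w -> jet2 g w -> jet2 (fun z => f z * g z) w.
Proof.
move=> [a0 [a1 [s cs hs]]] [b0 [b1 [t ct ht]]].
exists (a0 * b0), (a0 * b1 + a1 * b0), (fun k => a0 * t k + a1 * b1 + s k * b0 +
  (a1 * t k + s k * b1) * k + s k * t k * k ^+ 2).
  apply: cvgD; first apply: cvgD; first apply: cvgD; first apply: cvgD.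
  - by apply: cvgM => //; exact: cvg_cst.
  - exact: cvg_cst.
  - by apply: cvgM => //; exact: cvg_cst.
  - apply: cvgM; last apply: cvg_near0.
    by apply: cvgD; apply: cvgM => //; exact: cvg_cst.
  - apply: cvgM; first by apply: cvgM.
    by exact: sqr_cvg0.
by apply: filterS2 hs ht => k -> ->; ring.
Qed.

Lemma jet2_val f w : jet2 f w -> exists a1 : C, exists2 eta : C -> C,
  eta k @[k --> near0] --> eta 0 &
  \forall k \near near0, f (w + k) = f w + a1 * k + eta k * k ^+ 2.
Proof.
move=> [a0 [a1 [s cs hs]]]; exists a1, s => //.
by have := nbhs_singleton hs; rewrite /= !(addr0, expr0n, mulr0) => ->.
Qed.

Lemma jet2_continuous f w : jet2 f w -> f (w + k) @[k --> near0] --> f w.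
Proof.
move=> [a0 [a1 [s cs hs]]].
have := nbhs_singleton hs; rewrite /= addr0 => ->.
apply: (@cvg_trans _ (a0 + a1 * k + s k * k ^+ 2 @[k --> near0])).
  by apply: near_eq_cvg; apply: filterS hs => k ->.
apply: cvgD; first apply: cvgD.
- exact: cvg_cst.
- by apply: cvgM; [exact: cvg_cst|apply: cvg_near0].
- by apply: cvgM => //; exact: sqr_cvg0.
Qed.

Lemma jet2V f w : f w != 0 -> jet2 f w -> jet2 (fun z => (f z)^-1) w.
Proof.
move=> fw0 /[dup] /jet2_continuous cf /jet2_val [b1 [t ct ht]].
set b0 := f w in fw0 ht.
exists b0^-1, (- b1 / b0 ^+ 2), (fun k => (b1 ^+ 2 - b0 * t k + b1 * t k * k) /
  (b0 ^+ 2 * f (w + k))).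
  apply: cvgM.
    apply: cvgD; first apply: cvgD.
    - exact: cvg_cst.
    - by apply: cvgN; apply: cvgM => //; exact: cvg_cst.
    - by apply: cvgM; [apply: cvgM => //; exact: cvg_cst|apply: cvg_near0].
  apply: cvgV; rewrite addr0; first by rewrite mulf_neq0 ?expf_neq0.
  by apply: cvgM => //; exact: cvg_cst.
have nz : \forall k \near near0, f (w + k) != 0.
  exact: (cvgr_neq0 _ cf).
apply: filterS2 nz ht => k nk e; rewrite e in nk *.
by field; rewrite fw0 nk.
Qed.

End Jets.

Section ComplexTopology.
Variable R : realType.

Lemma near0_normcP (P : R[i] -> Prop) : (\forall k \near @near0 R[i], P k) <->
  exists2 d : R, 0 < d & forall k, normc k < d -> P k.
Proof.
apply: (iff_trans (@nbhs_norm0P _ (R[i] : numFieldType) P)); split=> [[e /= e0 he]|[d d0 hd]].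
  have e_real : e \is Num.real by exact: gtr0_real.
  exists (complex.Re e); first by rewrite -ltcR RRe_real.
  by move=> k hk; apply: he; rewrite /= normr_normc -[e]RRe_real // ltcR.
exists d%:C; first by rewrite /= ltcR.
by move=> k /=; rewrite normr_normc ltcR => /hd.
Qed.

Lemma cvg_near0_normcP (h : R[i] -> R[i]) (l : R[i]) :
  h k @[k --> @near0 R[i]] --> (l : (R[i] : numFieldType)) <->
  forall e, 0 < e -> exists2 d : R, 0 < d & forall k, normc k < d ->
    normc (h k - l) < e.
Proof.
apply: (iff_trans (@cvgrPdist_lt _ (R[i] : numFieldType) _ _ _ h l)).
split=> [H e e0|H e e0].
  have ec0 : 0 < e%:C by rewrite ltcR.
  have /near0_normcP[d d0 hd] := H e%:C ec0; exists d => // k /hd.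
  by rewrite normr_normc ltcR normc_distC.
have e_real : e \is Num.real by exact: gtr0_real.
have [|d d0 hd] := H (complex.Re e); first by rewrite -ltcR RRe_real.
apply/near0_normcP; exists d => // k /hd.
by rewrite normr_normc -ltcR RRe_real // normc_distC.
Qed.

End ComplexTopology.

(** * The maximum principle *)

Section MaximumPrinciple.
Variable R : realType.

(** In the sum of the four increments the terms of order one cancel in pairs,
    and those of order two cancel since (i t)^2 = - t^2. *)
Lemma jet2_four_points (h : R[i] -> R[i]) w : jet2 h w ->
  forall e : R, 0 < e -> exists2 d : R, 0 < d & forall t : R, 0 < t < d ->
  normc (h (w + t%:C) + h (w - t%:C) + h (w + 'i * t%:C) + h (w - 'i * t%:C)
    - 4%:R * h w) <= e * t ^+ 2.
Proof.
move=> /jet2_val[a1 [eta ceta /near0_normcP[d1 d10 hd1]]] e e0.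
have e4 : 0 < e / 4 by rewrite divr_gt0.
have [d2 d20 hd2] := (cvg_near0_normcP eta (eta 0)).1 ceta _ e4.
exists (Num.min d1 d2); first by rewrite lt_min d10.
move=> t /andP[t0]; rewrite lt_min => /andP[t1 t2].
have n1 : normc t%:C = t by rewrite normc_real gtr0_norm.
have n2 : normc (- t%:C) = t by rewrite normcN.
have n3 : normc ('i * t%:C) = t by rewrite normcM normc_i mul1r.
have n4 : normc (- ('i * t%:C)) = t by rewrite normcN.
rewrite !hd1 ?n1 ?n2 ?n3 ?n4 //.
have -> : ('i * t%:C) ^+ 2 = - t%:C ^+ 2 by rewrite exprMn sqr_i mulN1r.
have -> : (- ('i * t%:C)) ^+ 2 = - t%:C ^+ 2 by rewrite sqrrN exprMn sqr_i mulN1r.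
have k1 := hd2 t%:C; have k2 := hd2 (- t%:C); have k3 := hd2 ('i * t%:C).
have k4 := hd2 (- ('i * t%:C)).
rewrite n1 in k1; rewrite n2 in k2; rewrite n3 in k3; rewrite n4 in k4.
have {}k1 := k1 t2; have {}k2 := k2 t2; have {}k3 := k3 t2; have {}k4 := k4 t2.
have -> : h w + a1 * t%:C + eta t%:C * t%:C ^+ 2 +
  (h w + a1 * - t%:C + eta (- t%:C) * (- t%:C) ^+ 2) +
  (h w + a1 * ('i * t%:C) + eta ('i * t%:C) * - t%:C ^+ 2) +
  (h w + a1 * - ('i * t%:C) + eta (- ('i * t%:C)) * - t%:C ^+ 2) - 4%:R * h w =
  (((eta t%:C - eta 0) + (eta (- t%:C) - eta 0)) -
   ((eta ('i * t%:C) - eta 0) + (eta (- ('i * t%:C)) - eta 0))) * t%:C ^+ 2 by ring.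
rewrite normcM normcX n1 ler_wpM2r ?sqr_ge0 //.
apply: le_trans (normcB _ _) _.
have := le_normcD (eta t%:C - eta 0) (eta (- t%:C) - eta 0).
have := le_normcD (eta ('i * t%:C) - eta 0) (eta (- ('i * t%:C)) - eta 0).
move: k1 k2 k3 k4.
lra.
Qed.

Lemma continuous_Re_plane (h : R[i] -> R[i]) (k : R[i]) (p : R * R) :
  h (p.1 +i* p.2 + u) @[u --> @near0 R[i]] --> (h (p.1 +i* p.2) : (R[i] : numFieldType)) ->
  {for p, continuous (fun q : R * R => complex.Re (k * h (q.1 +i* q.2)))}.
Proof.
move=> /(cvg_near0_normcP (fun u => h (p.1 +i* p.2 + u))) hc.
apply/cvgrPdist_lt => e e0.
have k0 : 0 < normc k + 1 by rewrite ltr_wpDl ?normc_ge0.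
have [d d0 hd] := hc _ (divr_gt0 e0 k0).
have d2 : 0 < d / 2 by rewrite divr_gt0.
near=> q.
rewrite -raddfB -mulrBr /=; apply: le_lt_trans (normc_Re _) _.
rewrite normcM normc_distC.
have -> : q.1 +i* q.2 = p.1 +i* p.2 + ((q.1 - p.1) +i* (q.2 - p.2)).
  by apply/eqP; rewrite eq_complex /= ![_ + (_ - _)]addrC !subrK !eqxx.
have hq : normc ((q.1 - p.1) +i* (q.2 - p.2)) < d.
  apply: le_lt_trans (normc_ReIm _) _; rewrite /= distrC [X in _ + X]distrC.
  have -> : d = d / 2 + d / 2 by field.
  apply: ltrD; near: q.
    by apply: (@cvgr_dist_lt _ _ _ (nbhs p)) => //; exact: cvg_fst.
  by apply: (@cvgr_dist_lt _ _ _ (nbhs p)) => //; exact: cvg_snd.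
have := hd _ hq; rewrite ltr_pdivlMr // => hlt.
apply: le_lt_trans hlt; rewrite mulrC ler_wpM2l ?normc_ge0 //.
by rewrite lerDl.
Unshelve. all: by end_near. Qed.

Definition in_square (c : R[i]) (s : R) (z : R[i]) :=
  `|complex.Re z - complex.Re c| <= s /\ `|complex.Im z - complex.Im c| <= s.

Definition on_square_edge (c : R[i]) (s : R) (z : R[i]) :=
  in_square c s z /\
  (`|complex.Re z - complex.Re c| = s \/ `|complex.Im z - complex.Im c| = s).

(** If |h| exceeded 1 at some z1, the function psi(z) = Re (h(z1)^* h(z))
    + e |z - c|^2 with e small would still have its maximum over the square at
    an interior point w other than c. This contradicts [jet2_four_points] at w,
    because the term e |z - c|^2 adds 4 e t^2 to the sum of the four increments.
    At c mere continuity and the value 0 are enough. *)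
Lemma max_principle (h : R[i] -> R[i]) (c : R[i]) (s : R) : 0 < s ->
  (forall z, in_square c s z -> z != c -> jet2 h z) ->
  h (c + k) @[k --> @near0 R[i]] --> (h c : (R[i] : numFieldType)) -> h c = 0 ->
  (forall z, on_square_edge c s z -> normc (h z) <= 1) ->
  forall z, in_square c s z -> normc (h z) <= 1.
Proof.
move=> s0 hjet hcont hc0 hedge z1 hz1; rewrite leNgt; apply/negP.
set m := normc (h z1) => m1.
(* On the square |z - c|^2 <= 2 s^2, so the perturbation is at most half of
   m^2 - m. *)
pose e := (m ^+ 2 - m) / (4 * s ^+ 2).
have s2 : 0 < s ^+ 2 by rewrite exprn_gt0.
have mm : 0 < m ^+ 2 - m by rewrite subr_gt0 expr2 ltr_pMr // (lt_trans ltr01).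
have e0 : 0 < e by rewrite divr_gt0 // mulr_gt0.
pose Q (x y : R) := (x - complex.Re c) ^+ 2 + (y - complex.Im c) ^+ 2.
pose psi (q : R * R) := complex.Re ((h z1)^* * h (q.1 +i* q.2)) + e * Q q.1 q.2.
pose a := complex.Re c; pose b := complex.Im c.
pose S := `[a - s, a + s]%classic `*` `[b - s, b + s]%classic.
have SE x y : S (x, y) <-> in_square c s (x +i* y).
  rewrite /S /in_square /= !in_itv /= !ler_distl; split.
    by move=> [-> ->].
  by move=> [-> ->].
have hcont' z : in_square c s z -> h (z + k) @[k --> @near0 R[i]] --> (h z : (R[i] : numFieldType)).
  by move=> hz; have [->//|zc] := eqVneq z c; apply: jet2_continuous; exact: hjet.
have [[x y] xyS hmax] : exists2 p, p \in S & forall t, t \in S -> psi t <= psi p.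
  apply: compact_EVT_max.
  - by exists (a, b); apply/SE; split; rewrite /= subrr normr0 ltW.
  - by apply: compact_setX; exact: segment_compact.
  apply: continuous_in_subspaceT => p; rewrite inE => pS.
  apply: cvgD; first by apply: continuous_Re_plane; apply: hcont'; case: p pS => ? ? /SE.
  apply: cvgM; first exact: cvg_cst.
  have c1 : q.1 - complex.Re c @[q --> p] --> p.1 - complex.Re c.
    by apply: cvgB; [exact: cvg_fst|exact: cvg_cst].
  have c2 : q.2 - complex.Im c @[q --> p] --> p.2 - complex.Im c.
    by apply: cvgB; [exact: cvg_snd|exact: cvg_cst].
  by apply: cvgD; rewrite expr2; apply: cvgM.
move: xyS; rewrite inE => /SE; set w := x +i* y => wS.
have psi_z1 : m ^+ 2 <= psi (complex.Re z1, complex.Im z1).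
  rewrite /psi /=; have -> : complex.Re z1 +i* complex.Im z1 = z1 by case: (z1).
  rewrite /m sqr_normc_ReIm; case: (h z1) => p1 p2 /=.
  have : 0 <= e * Q (complex.Re z1) (complex.Im z1).
    by rewrite mulr_ge0 ?(ltW e0) // addr_ge0 ?sqr_ge0.
  by rewrite mulNr opprK !expr2; lra.
have psi_w : m ^+ 2 <= psi (x, y).
  apply: le_trans psi_z1 _; apply: hmax; rewrite inE; apply/SE.
  by case: (z1) hz1.
have Qle z : in_square c s z -> Q (complex.Re z) (complex.Im z) <= 2 * s ^+ 2.
  move=> [h1 h2]; rewrite /Q mulr_natl mulr2n; apply: lerD.
    by rewrite -real_normK ?num_real // lerXn2r ?nnegrE // ltW.
  by rewrite -real_normK ?num_real // lerXn2r ?nnegrE // ltW.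
have w_edge : ~ on_square_edge c s w.
  move=> /hedge hw; have := Qle _ wS; rewrite /=.
  have : complex.Re ((h z1)^* * h w) <= m.
    apply: le_trans (ler_norm _) _; apply: le_trans (normc_Re _) _.
    rewrite normcM; have -> : normc (h z1)^* = m by rewrite /m; case: (h z1) => ? ? /=; rewrite sqrrN.
    by rewrite ler_piMr // /m normc_ge0.
  move: psi_w; rewrite /psi /= -/w.
  have : e * (2 * s ^+ 2) = (m ^+ 2 - m) / 2.
    by rewrite /e; field; rewrite gt_eqF.
  move=> es p1 p2 Qs.
  have : e * Q x y <= e * (2 * s ^+ 2) by rewrite ler_wpM2l // ltW.
  by rewrite es; move: p1 p2 mm; lra.
have w_c : w != c.
  apply/eqP => wc; move: psi_w; rewrite /psi /= -/w wc hc0 mulr0 /=.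
  have [<- <-] : complex.Re c = x /\ complex.Im c = y by rewrite -wc.
  rewrite /Q !subrr expr0n /= addr0 mulr0 addr0.
  by rewrite leNgt exprn_gt0 // (lt_trans ltr01).
have x_int : `|x - a| < s.
  rewrite lt_neqAle; have [-> _] := wS; rewrite andbT; apply/eqP => xs.
  by apply: w_edge; split => //; left.
have y_int : `|y - b| < s.
  rewrite lt_neqAle; have [_ ->] := wS; rewrite andbT; apply/eqP => ys.
  by apply: w_edge; split => //; right.
have m0 : 0 < m by exact: lt_trans m1.
have [d d0 hd] := jet2_four_points (hjet _ wS w_c) (divr_gt0 e0 m0).
pose t := Num.min (d / 2) (Num.min (s - `|x - a|) (s - `|y - b|)).
have t0 : 0 < t by rewrite !lt_min divr_gt0 //= !subr_gt0 x_int.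
have td : t < d by rewrite !gt_min; apply/orP; left; lra.
have tx : t <= s - `|x - a| by rewrite !ge_min lexx !orbT.
have ty : t <= s - `|y - b| by rewrite !ge_min lexx !orbT.
have inS u v : `|u| <= t -> `|v| <= t -> psi (x + u, y + v) <= psi (x, y).
  move=> hu hv; apply: hmax; rewrite inE; apply/SE; split => /=.
    rewrite addrAC; apply: le_trans (ler_normD _ _) _; rewrite -/a; lra.
  rewrite addrAC; apply: le_trans (ler_normD _ _) _; rewrite -/b; lra.
have tt : `|t| <= t by rewrite gtr0_norm.
have tN : `|- t| <= t by rewrite normrN.
have t00 : `|0 : R| <= t by rewrite normr0 ltW.
have := inS _ _ t00 tN; have := inS _ _ t00 tt.
have := inS _ _ tN t00; have := inS _ _ tt t00.
rewrite /psi /= !addr0.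
have -> : (x + t) +i* y = w + t%:C by rewrite /w; simpc.
have -> : (x - t) +i* y = w - t%:C by rewrite /w; simpc.
have -> : x +i* (y + t) = w + 'i * t%:C by rewrite /w; simpc.
have -> : x +i* (y - t) = w - 'i * t%:C by rewrite /w; simpc.
rewrite -/w => i1 i2 i3 i4.
have td0 : 0 < t < d by rewrite t0.
have := hd _ td0; set H4 := (X in normc X) => n4.
have : complex.Re ((h z1)^* * H4) >= - (e * t ^+ 2).
  rewrite -lerNl; apply: le_trans (ler_norm _) _; rewrite normrN; apply: le_trans (normc_Re _) _.
  rewrite normcM; have -> : normc (h z1)^* = m by rewrite /m; case: (h z1) => ? ? /=; rewrite sqrrN.
  apply: le_trans (_ : m * (e / m * t ^+ 2) <= _); first by rewrite ler_pM2l.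
  by rewrite le_eqVlt; apply/orP; left; apply/eqP; field; rewrite gt_eqF.
have -> : complex.Re ((h z1)^* * H4) = complex.Re ((h z1)^* * h (w + t%:C)) +
   complex.Re ((h z1)^* * h (w - t%:C)) + complex.Re ((h z1)^* * h (w + 'i * t%:C)) +
   complex.Re ((h z1)^* * h (w - 'i * t%:C)) - 4 * complex.Re ((h z1)^* * h w).
  rewrite /H4 mulrBr !mulrDr mulr_natl mulrnAr.
  by rewrite raddfB raddfMn !raddfD /=; ring.
have Q4 : Q (x + t) y + Q (x - t) y + Q x (y + t) + Q x (y - t) = 4 * Q x y + 4 * t ^+ 2.
  by rewrite /Q; ring.
have et : 0 < e * t ^+ 2 by rewrite mulr_gt0 // exprn_gt0.
have : e * Q (x + t) y + e * Q (x - t) y + e * Q x (y + t) + e * Q x (y - t) =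
   4 * (e * Q x y) + 4 * (e * t ^+ 2) by rewrite -!mulrDr Q4; ring.
have arith (A B C D E q1 q2 q3 q4 q u : R) : A + q1 <= E + q -> B + q2 <= E + q ->
  C + q3 <= E + q -> D + q4 <= E + q -> 0 < u -> - u <= A + B + C + D - 4 * E ->
  q1 + q2 + q3 + q4 = 4 * q + 4 * u -> False by lra.
by move=> h1 h2; exact: (arith _ _ _ _ _ _ _ _ _ _ _ i1 i2 i3 i4 et h2 h1).
Qed.

End MaximumPrinciple.

(** * The Schwarz-Pick inequality *)

Section SchwarzPick.
Variable R : realType.
Implicit Types (f : R[i] -> R[i]) (z c : R[i]).

Lemma normc_conj z : normc z^* = normc z.
Proof. by case: z => a b /=; rewrite sqrrN. Qed.

Lemma normc_sub_conj (u v : R[i]) : 0 <= complex.Im u -> 0 <= complex.Im v ->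
  normc (u - v) <= normc (u - v^*).
Proof.
case: u v => [a b] [c d] /= b0 d0; rewrite opprK ler_wsqrtr // lerD2l.
rewrite sqrrB sqrrD; have := mulr_ge0 b0 d0; rewrite mulr2n; lra.
Qed.

Lemma sub_conj_neq0 (u v : R[i]) : 0 < complex.Im u -> 0 < complex.Im v -> u - v^* != 0.
Proof.
move=> u0 v0; apply/eqP => /(congr1 (@complex.Im _)).
by case: u v u0 v0 => [a b] [c d] /=; lra.
Qed.

(** With g = (f - f(c)) / (f - f(c)^* ), of modulus at most 1, the maximum
    principle is applied to h(z) = g(z)^2 s / (z - c). On the edge of the
    square |z - c| >= s, so |h| <= 1. Squaring g makes h vanish at c, which
    avoids a removable singularity; the resulting exponent 1/2 in the bound for
    |g| is harmless. *)
Lemma schwarz_pick_jet f c (s : R) : 0 < s ->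
  (forall z, in_square c s z -> jet2 f z) ->
  (forall z, in_square c s z -> 0 < complex.Im (f z)) ->
  forall z, in_square c s z ->
  normc (f z - f c) ^+ 2 * s <= normc (z - c) * normc (f z - (f c)^*) ^+ 2.
Proof.
move=> s0 fjet fpos.
pose g z := (f z - f c) * (f z - (f c)^*)^-1.
pose h z := g z * g z * (s%:C * (z - c)^-1).
have cS : in_square c s c by split; rewrite subrr normr0 ltW.
have nz z : in_square c s z -> f z - (f c)^* != 0.
  by move=> zS; apply: sub_conj_neq0; exact: fpos.
have gjet z : in_square c s z -> jet2 g z.
  move=> zS; apply: jet2M; first by apply: jet2D; [exact: fjet|exact: jet2_cst].
  apply: jet2V; first exact: nz.
  by apply: jet2D; [exact: fjet|exact: jet2_cst].
have hjet z : in_square c s z -> z != c -> jet2 h z.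
  move=> zS zc; apply: jet2M; first by apply: jet2M; exact: gjet.
  apply: jet2M; first exact: jet2_cst.
  apply: jet2V; first by rewrite subr_eq0.
  by apply: jet2D; [exact: jet2_id|exact: jet2_cst].
have hc0 : h c = 0 by rewrite /h subrr invr0 !mulr0.
have hcont : h (c + k) @[k --> @near0 R[i]] --> (h c : (R[i] : numFieldType)).
  have [a1 [eta ceta hf]] := jet2_val (fjet _ cS).
  have cf := jet2_continuous (fjet _ cS).
  apply: (@cvg_trans _ (k * (s%:C * (((a1 + eta k * k) * (f (c + k) - (f c)^*)^-1) *
    ((a1 + eta k * k) * (f (c + k) - (f c)^*)^-1))) @[k --> @near0 R[i]])).
    apply: near_eq_cvg; apply: filterS hf => k hk.
    rewrite /h /g [c + k]addrC addrK -[k + c]addrC.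
    have -> : f (c + k) - f c = k * (a1 + eta k * k) by rewrite hk; ring.
    have [->|k0] := eqVneq k 0; first by rewrite !mul0r.
    have -> : k * (a1 + eta k * k) * (f (c + k) - (f c)^*)^-1 =
      k * ((a1 + eta k * k) * (f (c + k) - (f c)^*)^-1) by rewrite mulrA.
    by move: (_ * _^-1) => w; field.
  rewrite hc0 -(mul0r (s%:C * (((a1 + eta 0 * 0) * (f c - (f c)^*)^-1) *
    ((a1 + eta 0 * 0) * (f c - (f c)^*)^-1)))).
  apply: cvgM; first exact: cvg_near0.
  apply: cvgM; first exact: cvg_cst.
  have cq : (a1 + eta k * k) * (f (c + k) - (f c)^*)^-1 @[k --> @near0 R[i]] -->
     ((a1 + eta 0 * 0) * (f c - (f c)^*)^-1 : (R[i] : numFieldType)).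
    have cn : a1 + eta k * k @[k --> @near0 R[i]] --> (a1 + eta 0 * 0 : (R[i] : numFieldType)).
      apply: cvgD; first exact: cvg_cst.
      by apply: cvgM; [exact: ceta|exact: cvg_near0].
    apply: cvgM; first exact: cn.
    apply: cvgV; first exact: nz.
    by apply: cvgD; [exact: cf|exact: cvg_cst].
  exact: cvgM.
have g1 z : in_square c s z -> normc (g z) <= 1.
  move=> zS; rewrite /g normcM normcV ler_pdivrMr ?normc_gt0 ?nz // mul1r.
  by apply: normc_sub_conj; rewrite ltW // fpos.
have hedge z : on_square_edge c s z -> normc (h z) <= 1.
  move=> [zS zedge]; rewrite /h (normcM (g z * g z)) (normcM (g z)) (normcM s%:C) normcV
    normc_real gtr0_norm //.
  have sz : s <= normc (z - c).
    case: zedge => <-; rewrite -raddfB /=; [exact: normc_Re|exact: normc_Im].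
  have z0 : 0 < normc (z - c) by exact: lt_le_trans sz.
  apply: mulr_ile1; rewrite ?mulr_ge0 ?invr_ge0 ?normc_ge0 ?(ltW s0) //.
    by apply: mulr_ile1; rewrite ?normc_ge0 // g1.
  by rewrite ler_pdivrMr // mul1r.
move=> z zS; have := max_principle s0 hjet hcont hc0 hedge zS.
have [->|zc] := eqVneq z c.
  by rewrite !subrr normc0 expr0n /= !mul0r.
have zc0 : 0 < normc (z - c) by rewrite normc_gt0 subr_eq0.
have fz0 : 0 < normc (f z - (f c)^*) by rewrite normc_gt0 nz.
rewrite /h /g !normcM !normcV normc_real gtr0_norm // => hle.
rewrite -subr_ge0.
have -> : normc (z - c) * normc (f z - (f c)^*) ^+ 2 - normc (f z - f c) ^+ 2 * s =
  (1 - (normc (f z - f c) / normc (f z - (f c)^*) *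
    (normc (f z - f c) / normc (f z - (f c)^*)) * (s / normc (z - c)))) *
  (normc (z - c) * normc (f z - (f c)^*) ^+ 2).
  by field; rewrite !gt_eqF.
by rewrite mulr_ge0 ?subr_ge0 // mulr_ge0 ?sqr_ge0 // ltW.
Qed.

Lemma normc_dist (u v : R[i]) : `|normc u - normc v| <= normc (u - v).
Proof.
rewrite ler_distl; apply/andP; split.
  by rewrite lerBlDr -[X in normc X <= _](subrK u) normc_distC addrC; exact: le_normcD.
by rewrite -lerBlDl lerBlDr -[X in normc X <= _](subrK v); exact: le_normcD.
Qed.

(** The inequality is proved first for the functions
    fd(z) = (G(z + d) - G(z)) / d + i d, where G is a primitive of f. They have
    second-order expansions, their imaginary part is positive, and they
    converge to f as d decreases to 0. *)
Lemma schwarz_pick_square f c (s : R) : 0 < s < complex.Im c ->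
  (forall z, 0 < complex.Im z -> exists D, cdiff f z D) ->
  (forall z, 0 < complex.Im z -> 0 <= complex.Im (f z)) ->
  forall z, in_square c s z ->
  normc (f z - f c) ^+ 2 * s <= normc (z - c) * normc (f z - (f c)^*) ^+ 2.
Proof.
move=> /andP[s0 sc] hf fpos.
pose a := complex.Re c - s - 2; pose a' := complex.Re c - s - 1.
pose b' := (complex.Im c - s) / 2.
have aa' : a < a' by rewrite /a /a'; lra.
have b'0 : 0 < b' by rewrite /b'; lra.
have [G [hG Gpos]] := holomorphic_primitive aa' b'0 (fun z _ => hf z).
have {Gpos}Gpos := Gpos (fun z _ bz => fpos z (lt_trans b'0 bz)).
have inD z : in_square c s z -> a' < complex.Re z /\ b' < complex.Im z.
  move=> [h1 h2]; move: h1 h2 sc; rewrite !ler_distl /a' /b' => /andP[? ?] /andP[? ?] ?.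
  by split; lra.
have Gjet z : a' < complex.Re z -> b' < complex.Im z -> jet2 G z.
  move=> az bz; have [D hD] := hG z az bz.
  exists (G z), (f z), (fun k => if k == 0 then D else (G (z + k) - G z - f z * k) / k ^+ 2).
    apply/cvg_near0_normcP => e e0; rewrite eqxx.
    have e2 : 0 < e / 2 by rewrite divr_gt0.
    have [d d0 hd] := hD _ e2.
    exists d => // k kd; have [_|k0] := eqVneq k 0; first by rewrite subrr normc0.
    have := hd k kd; have nk : 0 < normc k by rewrite normc_gt0.
    have -> : (G (z + k) - G z - f z * k) / k ^+ 2 - D =
      (G (z + k) - G z - f z * k - D * k ^+ 2) / k ^+ 2 by field.
    rewrite normcM normcV normcX => hle; apply: (@le_lt_trans _ _ (e / 2)); last by lra.
    by rewrite ler_pdivrMr ?exprn_gt0.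
  apply/near0_normcP; exists 1 => // k _; have [->|k0] := eqVneq k 0.
    by rewrite expr0n /= !mulr0 !addr0.
  by field.
pose fd (d : R) z := (G (z + d%:C) - G z) * (d%:C)^-1 + 'i * d%:C.
have fdjet (d : R) z : 0 < d -> in_square c s z -> jet2 (fd d) z.
  move=> d0 /inD[az bz]; apply: jet2D; last exact: jet2_cst.
  apply: jet2M; last exact: jet2_cst.
  apply: jet2D.
    have [||a0 [a1 [eta ceta heta]]] := Gjet (z + d%:C).
    - by case: z az {bz} => x y /=; lra.
    - by case: z az bz => x y /= _; rewrite addr0.
    exists a0, a1, eta => //; apply: filterS heta => k.
    by rewrite addrAC.
  have -> : (fun z => - G z) = (fun z => (-1) * G z) by apply/funext => ?; rewrite mulN1r.
  by apply: jet2M; [exact: jet2_cst|exact: Gjet].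
have fdpos (d : R) z : 0 < d -> in_square c s z -> 0 < complex.Im (fd d z).
  move=> d0 /inD[az bz]; rewrite /fd -fmorphV raddfD /=.
  have := Gpos z d az bz (ltW d0); move: (G _ - G z) => [u v] /= v0.
  rewrite mulr0 add0r !mul0r mul1r add0r ltr_wpDl // mulr_ge0 // invr_ge0 ltW //.
have fdlim z : in_square c s z -> forall e, 0 < e ->
    \forall d \near 0^'+, normc (fd d z - f z) < e.
  move=> /inD[az bz] e e0; have [D hD] := hG z az bz.
  have [r r0 hr] := hD 1 ltr01.
  have C0 : 0 < normc D + 2 by rewrite ltr_wpDl ?normc_ge0.
  near=> d; have d0 : 0 < d by near: d; exact: nbhs_right_gt.
  have dr : d < r by near: d; exact: nbhs_right_lt.
  have de : d < e / (normc D + 2) by near: d; apply: nbhs_right_lt; exact: divr_gt0.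
  have nd : normc d%:C = d by rewrite normc_real gtr0_norm.
  have := hr d%:C; rewrite nd => /(_ dr) hle.
  have dc0 : d%:C != 0 by rewrite -normc_gt0 nd.
  have -> : fd d z - f z = (G (z + d%:C) - G z - f z * d%:C - D * d%:C ^+ 2) / d%:C +
    (D * d%:C + 'i * d%:C) by rewrite /fd; field.
  apply: le_lt_trans (le_normcD _ _) _; rewrite normcM normcV nd.
  have h1 := le_normcD (D * d%:C) ('i * d%:C); rewrite !normcM normc_i nd mul1r in h1.
  have h2 : normc (G (z + d%:C) - G z - f z * d%:C - D * d%:C ^+ 2) / d <= d.
    by rewrite ler_pdivrMr // -expr2 -[d ^+ 2]mul1r.
  move: de; rewrite ltr_pdivlMr // => de.
  apply: le_lt_trans (lerD h2 h1) _; move: de; lra.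
move=> z zS.
have cS : in_square c s c by split; rewrite subrr normr0 ltW.
have lim1 : normc (fd d z - fd d c) @[d --> 0^'+] --> normc (f z - f c).
  apply/cvgrPdist_lt => e e0; have e2 : 0 < e / 2 by rewrite divr_gt0.
  near=> d; apply: le_lt_trans (normc_dist _ _) _.
  have -> : f z - f c - (fd d z - fd d c) = - (fd d z - f z) + (fd d c - f c) by ring.
  apply: le_lt_trans (le_normcD _ _) _; rewrite normcN.
  have -> : e = e / 2 + e / 2 by field.
  by apply: ltrD; near: d; exact: fdlim.
have lim2 : normc (fd d z - (fd d c)^*) @[d --> 0^'+] --> normc (f z - (f c)^*).
  apply/cvgrPdist_lt => e e0; have e2 : 0 < e / 2 by rewrite divr_gt0.
  near=> d; apply: le_lt_trans (normc_dist _ _) _.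
  have -> : f z - (f c)^* - (fd d z - (fd d c)^*) = - (fd d z - f z) + (fd d c - f c)^*.
    by rewrite raddfB /=; ring.
  apply: le_lt_trans (le_normcD _ _) _; rewrite normcN normc_conj.
  have -> : e = e / 2 + e / 2 by field.
  by apply: ltrD; near: d; exact: fdlim.
have l1 : normc (fd d z - fd d c) ^+ 2 * s @[d --> 0^'+] -->
    normc (f z - f c) ^+ 2 * s.
  by apply: cvgM; [rewrite expr2; exact: cvgM|exact: cvg_cst].
have l2 : normc (z - c) * normc (fd d z - (fd d c)^*) ^+ 2 @[d --> 0^'+] -->
    normc (z - c) * normc (f z - (f c)^*) ^+ 2.
  by apply: cvgM; [exact: cvg_cst|rewrite expr2; exact: cvgM].
apply: (ler_cvg_to l1 l2).
near=> d; have d0 : 0 < d by near: d; exact: nbhs_right_gt.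
apply: schwarz_pick_jet => // w; [exact: fdjet|exact: fdpos].
Unshelve. all: by end_near. Qed.

End SchwarzPick.

(** * The Harnack inequality *)

Section Harnack.
Variable R : realType.

(** By the triangle inequality |u - v^*| <= |u - v| + 2 Im v, and k < 1 allows to
    absorb |u - v| in the left-hand side. *)
Lemma pseudo_hyperbolic_bound (k : R) (u v : R[i]) : 0 <= k < 1 ->
  0 <= complex.Im v -> normc (u - v) <= k * normc (u - v^*) ->
  normc (u - v) <= 2 * k / (1 - k) * complex.Im v.
Proof.
move=> /andP[k0 k1] v0 h.
have d0 : 0 < 1 - k by rewrite subr_gt0.
rewrite mulrAC ler_pdivlMr //.
have : normc (u - v^*) <= normc (u - v) + 2 * complex.Im v.
  have -> : u - v^* = (u - v) + (v - v^*) by ring.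
  apply: le_trans (le_normcD _ _) _; rewrite lerD2l.
  case: v v0 {h} => a b /= b0; rewrite subrr expr0n add0r opprK sqrtr_sqr ger0_norm; lra.
move: h; move: (normc _) (normc _) => p q h1 h2.
have := ler_wpM2l k0 h2; lra.
Qed.

(** Squares with a centre high above z0 exhaust the upper half-plane. *)
Lemma square_centre (z z0 : R[i]) : 0 < complex.Im z -> 0 < complex.Im z0 ->
  exists c : R[i], exists2 s : R, 0 < s < complex.Im c &
    normc (z - c) < s /\ normc (z0 - c) < s.
Proof.
case: z z0 => [x y] [x0 y0] /= y_gt0 y0_gt0.
(* N is large enough for both points to have distance less than N from the
   point x0 + i N. *)
pose N := y + y0 + ((x - x0) ^+ 2) / y.
have q0 : 0 <= (x - x0) ^+ 2 / y by rewrite divr_ge0 ?sqr_ge0 // ltW.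
have N0 : 0 < N by rewrite /N; lra.
pose c := x0 +i* N.
have h1 : normc ((x +i* y) - c) < N.
  rewrite -(@ltr_pXn2r _ 2) ?nnegrE ?normc_ge0 ?(ltW N0) //.
  rewrite sqr_normc_ReIm /= -subr_gt0.
  have -> : N ^+ 2 - ((x - x0) ^+ 2 + (y - N) ^+ 2) =
     y ^+ 2 + 2 * y * y0 + (x - x0) ^+ 2.
    by rewrite /N; field; rewrite gt_eqF.
  by rewrite ltr_wpDr ?sqr_ge0 // ltr_pwDl ?exprn_gt0 // !mulr_ge0 ?ltW.
have h2 : normc ((x0 +i* y0) - c) < N.
  rewrite -(@ltr_pXn2r _ 2) ?nnegrE ?normc_ge0 ?(ltW N0) //.
  rewrite sqr_normc_ReIm /= subrr -subr_gt0.
  have -> : N ^+ 2 - (0 ^+ 2 + (y0 - N) ^+ 2) = y0 * (y0 + 2 * (y + (x - x0) ^+ 2 / y)).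
    by rewrite /N; field; rewrite gt_eqF.
  by rewrite mulr_gt0 //; lra.
pose r := Num.max (normc ((x +i* y) - c)) (normc ((x0 +i* y0) - c)).
have rN : r < N by rewrite gt_max h1.
have r0 : 0 <= r by rewrite le_max normc_ge0.
have r1 : normc ((x +i* y) - c) <= r by rewrite le_max lexx.
have r2 : normc ((x0 +i* y0) - c) <= r by rewrite le_max lexx orbT.
exists c, ((r + N) / 2) => /=; first by apply/andP; split; lra.
by split; [apply: le_lt_trans r1 _|apply: le_lt_trans r2 _]; lra.
Qed.

(** Both z and z0 are compared with the centre c of a common square. The bound
    of [pseudo_hyperbolic_bound] can be used in both directions, since
    |u - v^*| is symmetric in u and v. *)
Lemma harnack (z z0 : R[i]) : 0 < complex.Im z -> 0 < complex.Im z0 ->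
  exists2 K : R, 0 <= K & forall f : R[i] -> R[i],
    (forall w : R[i], 0 < complex.Im w -> exists D, cdiff f w D) ->
    (forall w : R[i], 0 < complex.Im w -> 0 <= complex.Im (f w)) ->
    normc (f z - f z0) <= K * complex.Im (f z0).
Proof.
move=> z_gt0 z0_gt0.
have [c [s sc [zs z0s]]] := square_centre z_gt0 z0_gt0.
have /andP[s0 sc'] := sc.
pose r := Num.max (normc (z - c)) (normc (z0 - c)).
have rs : r < s by rewrite gt_max zs.
have r0 : 0 <= r by rewrite le_max normc_ge0.
pose k := Num.sqrt (r / s).
have k0 : 0 <= k by exact: sqrtr_ge0.
have k1 : k < 1 by rewrite -sqrtr1 ltr_sqrt // ltr_pdivrMr // mul1r.
have k01 : 0 <= k < 1 by rewrite k0.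
have K0 : 0 <= 2 * k / (1 - k) by rewrite divr_ge0 ?mulr_ge0 // subr_ge0 ltW.
pose L := 2 * k / (1 - k).
exists (L * (1 + L) + L); first by rewrite /L addr_ge0 // mulr_ge0 // addr_ge0.
move=> f hf fpos.
have c_gt0 : 0 < complex.Im c by lra.
have main w : normc (w - c) <= r -> normc (f w - f c) <= k * normc (f w - (f c)^*).
  move=> wr; have wS : in_square c s w.
    have ws : normc (w - c) <= s by lra.
    by split; rewrite -raddfB; [apply: le_trans (normc_Re _) ws|apply: le_trans (normc_Im _) ws].
  have := schwarz_pick_square sc hf fpos wS; rewrite -ler_pdivlMr // => h.
  rewrite -(@ler_pXn2r _ 2) ?nnegrE ?mulr_ge0 ?normc_ge0 //.
  apply: le_trans h _; rewrite exprMn sqr_sqrtr ?divr_ge0 ?(ltW s0) // mulrAC.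
  by rewrite ler_wpM2r ?sqr_ge0 // ler_wpM2r ?invr_ge0 ?(ltW s0).
have z1 : normc (f z - f c) <= k * normc (f z - (f c)^*).
  by apply: main; rewrite le_max lexx.
have z2 : normc (f z0 - f c) <= k * normc (f z0 - (f c)^*).
  by apply: main; rewrite le_max lexx orbT.
have b1 := pseudo_hyperbolic_bound k01 (fpos _ c_gt0) z1.
have z2' : normc (f c - f z0) <= k * normc (f c - (f z0)^*).
  rewrite normc_distC; apply: le_trans z2 _.
  suff -> : normc (f z0 - (f c)^*) = normc (f c - (f z0)^*) by [].
  by rewrite -normc_conj raddfB /= conjcK normc_distC.
have b2 := pseudo_hyperbolic_bound k01 (fpos _ z0_gt0) z2'.
rewrite -/L in b1 b2.
have -> : f z - f z0 = (f z - f c) + (f c - f z0) by ring.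
apply: le_trans (le_normcD _ _) _.
have b3 : complex.Im (f c) <= (1 + L) * complex.Im (f z0).
  have : complex.Im (f c) - complex.Im (f z0) <= normc (f c - f z0).
    by apply: le_trans (normc_Im _); rewrite raddfB /= ler_norm.
  lra.
have := ler_wpM2l K0 b3; rewrite -/L; lra.
Qed.

End Harnack.

(** * Inner products *)

Section HilbertBasics.
Variables (R : realType) (H : completeNormedModType R[i]).
Variable dot : {dot H for Num.conj}.
Hypothesis hdot : induces_norm dot.
Implicit Types x y z : H.

Lemma dotDl x y z : dot (x + y) z = dot x z + dot y z.
Proof. exact: linearDl. Qed.

Lemma dotZl (a : R[i]) x y : dot (a *: x) y = a * dot x y.
Proof. exact: linearZl_LR. Qed.

Lemma dotC x y : dot y x = conjc (dot x y).
Proof. by rewrite hermC expr0 mul1r. Qed.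

Lemma dotDr x y z : dot x (y + z) = dot x y + dot x z.
Proof. by rewrite dotC dotDl raddfD /= -!dotC. Qed.

Lemma dotZr (a : R[i]) x y : dot x (a *: y) = conjc a * dot x y.
Proof. by rewrite dotC dotZl rmorphM /= -dotC. Qed.

Lemma dotNl x y : dot (- x) y = - dot x y.
Proof. by rewrite -scaleN1r dotZl mulN1r. Qed.

Lemma dotNr x y : dot x (- y) = - dot x y.
Proof. by rewrite -scaleN1r dotZr rmorphN rmorph1 mulN1r. Qed.

Lemma dot0l y : dot 0 y = 0.
Proof. by rewrite -(scale0r 0) dotZl mul0r. Qed.

Lemma dot0r y : dot y 0 = 0.
Proof. by rewrite dotC dot0l conjc0. Qed.

Lemma dot_suml (I : Type) (r : seq I) (P : pred I) (F : I -> H) y :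
  dot (\sum_(i <- r | P i) F i) y = \sum_(i <- r | P i) dot (F i) y.
Proof.
by elim/big_rec2: _ => [|i a b _ <-]; rewrite ?dot0l // dotDl.
Qed.

(** The norm of a complex normed module takes its values in the complex
    numbers; nrm is the same norm with real values. *)
Definition nrm x : R := complex.Re `|x|.

Lemma nrmE x : `|x| = (nrm x)%:C.
Proof. by rewrite /nrm RRe_real // normr_real. Qed.

Lemma nrm_ge0 x : 0 <= nrm x.
Proof. by rewrite -ler0c -nrmE. Qed.

Lemma nrm0 : nrm 0 = 0.
Proof. by rewrite /nrm normr0. Qed.

Lemma nrm_eq0 x : nrm x = 0 -> x = 0.
Proof. by move=> h; apply/normr0_eq0; rewrite nrmE h. Qed.

Lemma nrmD x y : nrm (x + y) <= nrm x + nrm y.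
Proof. by have := ler_normD x y; rewrite !nrmE -rmorphD /= lecR. Qed.

Lemma nrmN x : nrm (- x) = nrm x.
Proof. by rewrite /nrm normrN. Qed.

Lemma nrmZ (a : R[i]) x : nrm (a *: x) = normc a * nrm x.
Proof. by apply: complexI; rewrite -nrmE normrZ nrmE normr_normc -rmorphM. Qed.

Lemma dot_self x : dot x x = (nrm x ^+ 2)%:C.
Proof. by rewrite -hdot nrmE rmorphXn. Qed.

(** Expand the square of the norm of |y|^2 x - <x, y> y. *)
Lemma cauchy_schwarz x y : normc (dot x y) <= nrm x * nrm y.
Proof.
have [y0|y0] := eqVneq (nrm y) 0.
  by rewrite (nrm_eq0 y0) dot0r normc0 nrm0 mulr0.
have yp : 0 < nrm y ^+ 2 by rewrite exprn_gt0 // lt_neqAle eq_sym y0 nrm_ge0.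
pose a : R[i] := dot x y; pose B : R[i] := (nrm y ^+ 2)%:C.
have : 0 <= dot (B *: x - a *: y) (B *: x - a *: y) by rewrite dot_self ler0c sqr_ge0.
have -> : dot (B *: x - a *: y) (B *: x - a *: y) = B * ((nrm x ^+ 2)%:C * B - a * conjc a).
  have BB : conjc B = B by exact: conjc_real.
  rewrite dotDl !dotDr !dotNl !dotNr !dotZl !dotZr !dot_self BB (dotC x y) -/a -/B.
  ring.
rewrite -sqr_normc normr_normc -!(rmorphM, rmorphXn) -rmorphB -rmorphM ler0c.
rewrite pmulr_rge0 // subr_ge0 -exprMn ler_pXn2r //.
  by rewrite nnegrE normc_ge0.
by rewrite nnegrE mulr_ge0 ?nrm_ge0.
Qed.

Lemma nrm_sqrD x y : nrm (x + y) ^+ 2 = nrm x ^+ 2 + nrm y ^+ 2 + 2 * complex.Re (dot x y).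
Proof.
apply: complexI; rewrite -dot_self dotDl !dotDr !dot_self (dotC x y).
have E3 (a b c : R) : (a + b + c)%:C = a%:C + b%:C + c%:C by rewrite !rmorphD.
rewrite E3; have -> : (2 * complex.Re (dot x y))%:C = dot x y + conjc (dot x y).
  by rewrite addcJ rmorphM rmorph_nat.
ring.
Qed.

End HilbertBasics.

(** * The Riesz theorem and compact operators *)

Section Operators.
Variables (R : realType) (H : completeNormedModType R[i]).
Variable dot : {dot H for Num.conj}.
Hypothesis hdot : induces_norm dot.
Implicit Types x y z : H.
Implicit Types T A : H -> H.

Lemma nrm_ball x (d : R) y : ball x d%:C y <-> nrm (x - y) < d.
Proof. by rewrite -ball_normE /ball_ /= nrmE ltcR. Qed.

Lemma nbhs_nrmP x (P : set H) :
  nbhs x P <-> exists2 d : R, 0 < d & forall y, nrm (x - y) < d -> P y.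
Proof.
split=> [/nbhs_ballP[e /= e0 he]|[d d0 hd]].
  have er : e \is Num.real by exact: gtr0_real.
  exists (complex.Re e); first by rewrite -ltcR RRe_real.
  by move=> y /nrm_ball; rewrite RRe_real // => /he.
apply/nbhs_ballP; exists d%:C; first by rewrite /= ltcR.
by move=> y /nrm_ball /hd.
Qed.

Lemma nrm_complete (F : set_system H) : ProperFilter F ->
  (forall d, 0 < d -> exists x, F [set y | nrm (x - y) < d]) ->
  exists v, forall d, 0 < d -> F [set y | nrm (v - y) < d].
Proof.
move=> FF hF.
have /cauchy_cvg /cvg_ex[v hv] : cauchy F.
  apply: cauchy_exP => e e0.
  have er : e \is Num.real by exact: gtr0_real.
  have [|x hx] := hF (complex.Re e); first by rewrite -ltcR RRe_real.
  exists x; apply: filterS hx => y; rewrite /= -[e]RRe_real //.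
  by move/nrm_ball.
exists v => d d0; apply: hv; apply/nbhs_nrmP; by exists d.
Qed.

Section Linear.
Variable T : H -> H.
Hypothesis linT : linear T.

(** Operators are plain functions here, so the usual consequences of linearity
    are derived from the hypothesis that T is linear. *)
Lemma opD x y : T (x + y) = T x + T y.
Proof. by have := linT 1 x y; rewrite !scale1r. Qed.

Lemma op0 : T 0 = 0.
Proof. by apply: (@addrI _ (T 0)); rewrite -opD !addr0. Qed.

Lemma opZ a x : T (a *: x) = a *: T x.
Proof. by have := linT a x 0; rewrite op0 !addr0. Qed.

Lemma opN x : T (- x) = - T x.
Proof. by rewrite -scaleN1r opZ scaleN1r. Qed.

Lemma opB x y : T (x - y) = T x - T y.
Proof. by rewrite opD opN. Qed.

Lemma op_sum (I : Type) (r : seq I) (P : pred I) (F : I -> H) :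
  T (\sum_(i <- r | P i) F i) = \sum_(i <- r | P i) T (F i).
Proof. by elim/big_rec2: _ => [|i a b _ <-]; rewrite ?op0 // opD. Qed.

End Linear.

Lemma bounded_nrm T : bounded_op T ->
  exists2 K : R, 0 <= K & forall x, nrm (T x) <= K * nrm x.
Proof.
move=> [_ [M hM]]; exists (normc M) => [|x]; first exact: normc_ge0.
have h := hM x; have h0 : 0 <= M * `|x| by apply: le_trans h.
have := h; rewrite -(ger0_norm h0) normr_normc normcM nrmE [ `|x| ]nrmE lecR.
by rewrite normc_real ger0_norm ?nrm_ge0.
Qed.

(** The functional J(x) = |x|^2 - 2 Re phi(x) is bounded below, and by the
    parallelogram identity its minimizing sets form a Cauchy filter. Its limit v
    satisfies the Euler equation <y, v> = phi(y). *)
Lemma riesz (phi : H -> R[i]) (M : R) :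
  (forall a x y, phi (a *: x + y) = a * phi x + phi y) ->
  (forall x, normc (phi x) <= M * nrm x) ->
  exists v, forall x, phi x = dot x v.
Proof.
move=> lphi bphi.
have phi0 : phi 0 = 0.
  by have := lphi (-1) 0 0; rewrite scaler0 addr0 mulN1r addrC => /eqP; rewrite eq_sym addrN => /eqP.
have phiD x y : phi (x + y) = phi x + phi y.
  by have := lphi 1 x y; rewrite scale1r mul1r.
have phiZ a x : phi (a *: x) = a * phi x.
  by have := lphi a x 0; rewrite phi0 !addr0.
pose J x := nrm x ^+ 2 - 2 * complex.Re (phi x).
have Jlb x : - M ^+ 2 <= J x.
  have h : complex.Re (phi x) <= M * nrm x.
    by apply: le_trans (bphi x); apply: le_trans (normc_Re _); exact: ler_norm.
  have : 0 <= (nrm x - M) ^+ 2 by exact: sqr_ge0.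
  by rewrite /J sqrrB -mulr_natl; lra.
have infJ : has_inf (range J).
  split; first by exists (J 0), 0.
  by exists (- M ^+ 2) => _ [x _ <-].
pose m := inf (range J).
have mJ x : m <= J x by apply: ge_inf; [case: infJ|exists x].
pose B (e : R) := [set x | J x < m + e].
have B0 e : 0 < e -> B e !=set0.
  by move=> e0; have [_ [x _ <-] hx] := inf_adherent e0 infJ; exists x.
have FB : ProperFilter (filter_from [set e : R | 0 < e] B).
  apply: filter_from_proper; last by move=> e; exact: B0.
  apply: filter_from_filter; first by exists 1; rewrite /= ltr01.
  move=> i j /= i0 j0; exists (Num.min i j); first by rewrite /= lt_min i0.
  by move=> x; rewrite /B /= -ltrBlDl lt_min !ltrBlDl => /andP[].
have par x y : J x + J y = 2 * J (2^-1%:C *: (x + y)) + nrm (x - y) ^+ 2 / 2.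
  rewrite /J nrmZ normc_real (ger0_norm (_ : 0 <= 2^-1)) // exprMn phiZ phiD.
  rewrite !(nrm_sqrD hdot) nrmN (dotNr dot) raddfN /=.
  have -> : complex.Re (2^-1%:C * (phi x + phi y)) =
     2^-1 * (complex.Re (phi x) + complex.Re (phi y)).
    by case: (phi x) (phi y) => [? ?] [? ?] /=; ring.
  by field.
have [v hv] : exists v, forall d, 0 < d ->
    filter_from [set e : R | 0 < e] B [set y | nrm (v - y) < d].
  apply: nrm_complete => d d0.
  pose e := d ^+ 2 / 5.
  have e0 : 0 < e by rewrite divr_gt0 ?exprn_gt0.
  have [x Bx] := B0 e e0; exists x; exists e => // y By /=.
  rewrite -(@ltr_pXn2r _ 2) ?nnegrE ?nrm_ge0 ?(ltW d0) //.
  have := par x y; have := mJ (2^-1%:C *: (x + y)); move: Bx By e0; rewrite /B /= /e; lra.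
exists v => y; apply/eqP; rewrite -subr_eq0; apply/eqP.
suff key z : complex.Re (dot v z - conjc (phi z)) = 0.
  have k1 := key y; have := key ('i *: y); rewrite phiZ (dotZr dot) (dotC dot v y) in k1 *.
  case: (phi y) (dot v y) k1 => [a b] [c d] /=.
  rewrite !(mul0r, mul1r, mulr0, mulN1r, sub0r, addr0, add0r, opprK) => h1 h2.
  apply/eqP; rewrite eq_complex /=; apply/andP; split; apply/eqP; lra.
set r0 := complex.Re _.
have D0 : 0 < 1 + nrm z by rewrite ltr_pwDl ?nrm_ge0.
suff small d : 0 < d -> `|r0| <= d * (1 + nrm z).
  apply/eqP; rewrite -normr_le0; apply/ler_addgt0Pr => e e0; rewrite add0r.
  by apply: le_trans (small (e / (1 + nrm z)) _) _; rewrite ?divr_gt0 // divfK ?gt_eqF.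
move=> d0.
pose C := nrm z ^+ 2 + 1.
have C0 : 0 < C by rewrite ltr_wpDl ?sqr_ge0.
pose e := d ^+ 2 / C.
have e0 : 0 < e by rewrite divr_gt0 ?exprn_gt0.
have [x [xv Bx]] : exists x, nrm (v - x) < d /\ B e x.
  have h1 := hv d d0.
  have h2 : filter_from [set e : R | 0 < e] B (B e) by exists e.
  exact: (filter_ex (filterI h1 h2)).
pose r := complex.Re (dot x z - conjc (phi z)).
(* Almost optimal step for the quadratic polynomial J (x + t z). *)
pose t := - (r / C).
have Jt : J (x + t%:C *: z) = J x + 2 * t * r + t ^+ 2 * nrm z ^+ 2.
  rewrite /J (nrm_sqrD hdot) nrmZ normc_real exprMn real_normK ?num_real // phiD phiZ.
  rewrite (dotZr dot) conjc_real /r.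
  by case: (phi x) (phi z) (dot x z) => [? ?] [? ?] [? ?] /=; ring.
have rd : r ^+ 2 <= d ^+ 2.
  have h1 : m <= J x + 2 * t * r + t ^+ 2 * nrm z ^+ 2 by rewrite -Jt.
  have h2 : 2 * t * r + t ^+ 2 * nrm z ^+ 2 = - (r ^+ 2 / C) - (r / C) ^+ 2.
    by rewrite /t /C; field; rewrite gt_eqF.
  have h3 : r ^+ 2 / C <= e by have := sqr_ge0 (r / C); move: Bx; rewrite /B /=; lra.
  by move: h3; rewrite /e ler_pM2r ?invr_gt0.
have rd' : `|r| <= d.
  by rewrite -(@ler_pXn2r _ 2) ?nnegrE ?(ltW d0) // real_normK ?num_real.
have -> : r0 = r + complex.Re (dot (v - x) z).
  by rewrite /r0 /r (dotDl dot) (dotNl dot) !raddfB /=; ring.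
rewrite mulrDr mulr1; apply: le_trans (ler_normD _ _) _; apply: lerD => //.
apply: le_trans (normc_Re _) _; apply: le_trans (cauchy_schwarz hdot _ _) _.
by rewrite ler_wpM2r ?nrm_ge0 // ltW.
Qed.

(** By the Riesz theorem there is a vector v for adjoint to choose. *)
Lemma adjointP T : bounded_op T -> forall x y, dot (T x) y = dot x (adjoint dot T y).
Proof.
move=> bT x y.
have [K K0 hK] := bounded_nrm bT.
have linT := bT.1.
have [v hv] : exists v, forall x, dot (T x) y = dot x v.
  apply: (@riesz _ (K * nrm y)) => [a u w|u].
    by rewrite linT (dotDl dot) (dotZl dot).
  apply: le_trans (cauchy_schwarz hdot _ _) _.
  by rewrite mulrAC ler_wpM2r ?nrm_ge0.
rewrite /adjoint; case: xgetP => [w _ /= -> //|/(_ v)] /=.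
by move=> h; case: h.
Qed.

(** A substitute for the extraction of a convergent subsequence: the images
    under T of a decreasing family of nonempty subsets of the unit ball cluster
    at some point y. *)
Lemma compact_cluster T (S : R -> set H) : compact_op T ->
  (forall e, 0 < e -> exists u, S e u) ->
  (forall e e', e <= e' -> S e `<=` S e') ->
  (forall e u, S e u -> nrm u <= 1) ->
  exists y, forall e, 0 < e -> exists2 u, S e u & nrm (T u - y) < e.
Proof.
move=> [_ pT] Sex Smono Sball.
pose F := filter_from [set e : R | 0 < e] S.
have FF : ProperFilter F.
  apply: filter_from_proper; last by move=> e; exact: Sex.
  apply: filter_from_filter; first by exists 1; rewrite /= ltr01.
  move=> i j /= i0 j0; exists (Num.min i j); first by rewrite /= lt_min i0.
  by move=> x Sx; split; apply: Smono Sx; rewrite ge_min lexx ?orbT.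
move: pT; rewrite precompactE => cT.
have [|y [_ hy]] := cT (T @ F) _.
  exists 1; first by rewrite /= ltr01.
  move=> u Su; apply: subset_closure; exists u => //=.
  by rewrite nrmE lecR; exact: Sball Su.
exists y => e e0.
have h1 : (T @ F) (T @` S e) by exists e => // u Su; exists u.
have h2 : nbhs y [set z | nrm (y - z) < e] by apply/nbhs_nrmP; exists e.
have [_ [[u Su <-] /= hu]] := hy _ _ h1 h2.
by exists u => //; rewrite -nrmN opprB.
Qed.

(** By the bound, A is uniformly continuous on the unit ball for the seminorm
    |T x|. A filter on the closure of the image of the ball under A is lifted to
    an ultrafilter on the ball; its image under T converges, so its image under
    A is Cauchy. *)
Lemma compact_transfer T A (c : R) : compact_op T -> bounded_op A -> 0 <= c ->
  (forall x, nrm (A x) ^+ 2 <= c * (nrm (T x) ^+ 2 + nrm (T x) * nrm x)) ->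
  compact_op A.
Proof.
move=> cT bA c0 hA; split=> //.
have [bT pT] := cT; move: pT; rewrite !precompactE => pT.
set C := A @` _.
move=> G GG GC.
pose Q (i : set H * R) := [set u | nrm u <= 1 /\ exists2 y, i.1 y & nrm (y - A u) < i.2].
pose F := filter_from [set i : set H * R | G i.1 /\ 0 < i.2] Q.
have FF : ProperFilter F.
  apply: filter_from_proper.
    apply: filter_from_filter; first by exists (setT, 1); split; [exact: filterT|rewrite /= ltr01].
    move=> [S d] [S' d'] [/= GS d0] [/= GS' d0'].
    exists (S `&` S', Num.min d d'); first by split; [exact: filterI|rewrite /= lt_min d0].
    by move=> u [/= u1 [y [Sy Sy']]]; rewrite lt_min => /andP[h h']; split; split => //; exists y.
  move=> [S d] [/= GS d0].
  have [y [Sy Cy]] := filter_ex (filterI GS GC).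
  have yd : nbhs y [set z | nrm (y - z) < d] by apply/nbhs_nrmP; exists d.
  have [_ [[u /= u1 <-] hu]] := Cy _ yd.
  exists u; split; last by exists y.
  by move: u1; rewrite nrmE lecR.
have [U [UU FU]] := ultraFilterLemma FF.
have Uball : U [set u | nrm u <= 1].
  apply: FU; exists (setT, 1); first by split; [exact: filterT|rewrite /= ltr01].
  by move=> u [].
have UP : ProperFilter U by exact: ultra_proper.
have [|t [_ ht]] := pT (T @ U) _.
  apply: (@filterS _ U _ _ _ _ Uball) => u /= u1; apply: subset_closure.
  by exists u; rewrite //= nrmE lecR.
have {}ht e : 0 < e -> U [set u | nrm (t - T u) < e].
  move=> e0; case: (in_ultra_setVsetC [set u | nrm (t - T u) < e] UU) => // Un.
  have te : nbhs t [set z | nrm (t - z) < e] by apply/nbhs_nrmP; exists e.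
  have UTn : (T @ U) (~` [set z | nrm (t - z) < e]) by [].
  by have [z [nz zt]] := ht _ _ UTn te.
have [v hv] : exists v, forall d, 0 < d -> (A @ U) [set y | nrm (v - y) < d].
  apply: nrm_complete => d d0.
  pose e := Num.min 1 (d ^+ 2 / (9 * (c + 1))).
  have c1 : 0 < c + 1 by rewrite ltr_wpDl.
  have e0 : 0 < e by rewrite lt_min ltr01 divr_gt0 ?exprn_gt0 ?mulr_gt0.
  have hW : U [set u | nrm u <= 1 /\ nrm (t - T u) < e].
    by apply: filterI => //; exact: ht.
  have [u [u1 ut]] := filter_ex hW.
  exists (A u); apply: (@filterS _ U _ _ _ _ hW) => w [w1 wt] /=.
  rewrite -(@ltr_pXn2r _ 2) ?nnegrE ?nrm_ge0 ?(ltW d0) // -(opB bA.1).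
  apply: le_lt_trans (hA _) _.
  have h1 : nrm (T (u - w)) <= 2 * e.
    rewrite (opB bT.1); have -> : T u - T w = (t - T w) - (t - T u).
      by rewrite opprB [RHS]addrC [RHS]addrA subrK.
    by apply: le_trans (nrmD _ _) _; rewrite nrmN; lra.
  have h2 : nrm (u - w) <= 2 by apply: le_trans (nrmD _ _) _; rewrite nrmN; lra.
  have e1 : e <= 1 by rewrite ge_min lexx.
  have e2 : (9 * (c + 1)) * e <= d ^+ 2.
    by rewrite mulrC -ler_pdivlMr ?mulr_gt0 // ge_min lexx orbT.
  have n0 := nrm_ge0 (T (u - w)); have n1 := nrm_ge0 (u - w).
  have h3 : nrm (T (u - w)) ^+ 2 + nrm (T (u - w)) * nrm (u - w) <= 8 * e.
    have -> : 8 * e = 4 * (e * 1) + 2 * e * 2 by ring.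
    apply: lerD.
      apply: le_trans (_ : (2 * e) ^+ 2 <= _); first by rewrite lerXn2r ?nnegrE //; lra.
      rewrite exprMn expr2 mulrC.
      have -> : e ^+ 2 * (2 * 2) = 4 * (e * e) by ring.
      by rewrite ler_pM2l // ler_pM2l.
    by apply: ler_pM.
  apply: le_lt_trans (ler_wpM2l c0 h3) _.
  apply: lt_le_trans e2; have := mulr_ge0 c0 (ltW e0); lra.
exists v; split.
  move=> N /nbhs_nrmP[d d0 hd].
  have [u [u1 uv]] := filter_ex (@filterI _ U _ _ _ Uball (hv d d0)).
  by exists (A u); split; [exists u; rewrite //= nrmE lecR|exact: hd].
move=> S N GS /nbhs_nrmP[d d0 hd].
have d2 : 0 < d / 2 by rewrite divr_gt0.
have US : U (Q (S, d / 2)) by apply: FU; exists (S, d / 2).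
have [u [[_ [y Sy hy]] hu]] := filter_ex (@filterI _ U _ _ _ US (hv _ d2)).
exists y; split=> //; apply: hd.
have -> : v - y = (v - A u) - (y - A u) by rewrite opprB addrA subrK.
apply: le_lt_trans (nrmD _ _) _; rewrite nrmN; move: hy hu => /=; lra.
Qed.

End Operators.

(** * Eigenvectors obtained by maximization *)

Section LinearAlgebra.
Variable K : fieldType.

Lemma exists_left_kernel (m n : nat) (M : 'M[K]_(m, n)) : (n < m)%N ->
  exists2 a : 'rV[K]_m, a != 0 & a *m M = 0.
Proof.
move=> nm; have : kermx M != 0.
  by rewrite -mxrank_eq0 mxrank_ker -lt0n subn_gt0 (leq_ltn_trans (rank_leq_col M)).
by case/rowV0Pn => a /sub_kermxP aM a0; exists a.
Qed.

End LinearAlgebra.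

Section Dimension.
Variables (R : realType) (H : completeNormedModType R[i]).

(** More vectors than the dimension allows would be linearly dependent. *)
Lemma has_dim_leq (V : set H) m n : has_dim V m -> has_dim V n -> (m <= n)%N.
Proof.
move=> [e [free_e Ve]] [f [_ Vf]]; rewrite leqNgt; apply/negP => nm.
have /choice[M hM] : forall i, exists a : 'I_n -> R[i], e i = \sum_(j < n) a j *: f j.
  move=> i; have : V (e i).
    rewrite Ve; exists (fun j => (j == i)%:R) => //.
    rewrite (bigD1 i) //= eqxx scale1r big1 ?addr0 // => j /negbTE ->.
    by rewrite scale0r.
  by rewrite Vf => -[a _ <-]; exists a.
have [a a0 aM] := exists_left_kernel (\matrix_(i, j) M i j) nm.
case/negP: a0; apply/eqP/rowP => i; rewrite mxE; apply: free_e.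
rewrite (eq_bigr (fun i => \sum_(j < n) (a 0 i * M i j) *: f j)); last first.
  by move=> k _; rewrite hM scaler_sumr; apply: eq_bigr => j _; rewrite scalerA.
rewrite exchange_big big1 // => j _.
have aMj : \sum_(k < m) a 0 k * M k j = 0.
  have := congr1 (fun v : 'rV_n => v 0 j) aM; rewrite !mxE => e0.
  by rewrite -[RHS]e0; apply: eq_bigr => k _; rewrite mxE.
by rewrite -scaler_suml aMj scale0r.
Qed.

Lemma has_dim_inj (V : set H) m n : has_dim V m -> has_dim V n -> m = n.
Proof. by move=> hm hn; apply/eqP; rewrite eqn_leq !(@has_dim_leq V). Qed.

End Dimension.

Section Orthogonality.
Variables (R : realType) (H : completeNormedModType R[i]).
Variable dot : {dot H for Num.conj}.
Hypothesis hdot : induces_norm dot.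

Lemma pythagoras m (a : 'I_m -> R[i]) (w : 'I_m -> H) :
  (forall i j, i != j -> dot (w i) (w j) = 0) ->
  nrm (\sum_(i < m) a i *: w i) ^+ 2 = \sum_(i < m) normc (a i) ^+ 2 * nrm (w i) ^+ 2.
Proof.
move=> hw; apply: complexI; rewrite -(dot_self hdot) (dot_suml dot) rmorph_sum.
apply: eq_bigr => i _; rewrite (dotZl dot) (dotC dot) (dot_suml dot) (bigD1 i) //=.
rewrite (dotZl dot) (dot_self hdot) big1 => [|j ji]; last by rewrite (dotZl dot) hw ?mulr0.
have conjM (c : R[i]) (r : R) : conjc (c * r%:C) = conjc c * r%:C.
  by case: c => ? ?; simpc.
by rewrite addr0 conjM mulrA -sqr_normc normr_normc -rmorphXn -rmorphM.
Qed.

End Orthogonality.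

Section SingularSystem.
Variables (R : realType) (H : completeNormedModType R[i]).
Variable dot : {dot H for Num.conj}.
Hypothesis hdot : induces_norm dot.
Variable A : H -> H.
Hypothesis cA : compact_op A.
Local Notation B := (adjoint dot A).
Hypothesis bB : bounded_op B.
Implicit Types x y : H.

Let linA : linear A := cA.1.1.
Let linB : linear B := bB.1.

Lemma dot_adjointr x y : dot (A x) y = dot x (B y).
Proof. exact: (adjointP hdot cA.1). Qed.

Lemma dot_adjointl x y : dot (B x) y = dot x (A y).
Proof. by rewrite (dotC dot) -dot_adjointr -(dotC dot). Qed.

Lemma dot_BA x y : dot (B (A x)) y = dot x (B (A y)).
Proof. by rewrite dot_adjointl dot_adjointr. Qed.

Lemma dot_BA_self x : dot (B (A x)) x = (nrm (A x) ^+ 2)%:C.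
Proof. by rewrite dot_adjointl (dot_self hdot). Qed.

Definition perp (E : seq H) x := forall e, e \in E -> dot x e = 0.

(** Eigenvectors of the self-adjoint operator B A, where B is the adjoint
    of A. *)
Definition eigenfamily (E : seq H) :=
  forall e, e \in E -> exists l : R[i], B (A e) = l *: e.

Definition extremal (E : seq H) x := [/\ perp E x, nrm x <= 1 &
  forall y, perp E y -> nrm y <= 1 -> nrm (A y) <= nrm (A x)].

Lemma perpZ E (a : R[i]) x : perp E x -> perp E (a *: x).
Proof. by move=> h e /h hx; rewrite (dotZl dot) hx mulr0. Qed.

Lemma perp_BA E x : eigenfamily E -> perp E x -> perp E (B (A x)).
Proof.
move=> hE hx e eE; have [l hl] := hE e eE.
by rewrite dot_BA hl (dotZr dot) hx ?mulr0.
Qed.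

Lemma homogeneous_bound E s : (forall y, perp E y -> nrm y <= 1 -> nrm (A y) <= s) ->
  forall y, perp E y -> nrm (A y) <= s * nrm y.
Proof.
move=> hs y hy; have [y0|y0] := eqVneq (nrm y) 0.
  by rewrite (nrm_eq0 y0) (op0 linA) nrm0 mulr0.
have yp : 0 < nrm y by rewrite lt_neqAle eq_sym y0 nrm_ge0.
have := hs ((nrm y)^-1%:C *: y) (perpZ _ hy).
rewrite (opZ linA) !nrmZ normc_real ger0_norm ?invr_ge0 ?nrm_ge0 // mulVf // lexx.
by move=> /(_ isT); rewrite mulrC ler_pdivrMr.
Qed.

(** On the orthogonal complement of a family of eigenvectors, which B A leaves
    invariant, a vector that almost maximizes |A y| is almost an eigenvector of
    B A for the eigenvalue s^2: expand the square and use |B A y| <= s |A y|. *)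
Lemma BA_defect E s y : eigenfamily E ->
  (forall y, perp E y -> nrm y <= 1 -> nrm (A y) <= s) ->
  perp E y -> nrm y <= 1 ->
  nrm (B (A y) - (s ^+ 2)%:C *: y) ^+ 2 <= 2 * s ^+ 2 * (s ^+ 2 - nrm (A y) ^+ 2).
Proof.
move=> hE hs hy y1; have s0 : 0 <= s by apply: le_trans (hs y hy y1); exact: nrm_ge0.
rewrite (nrm_sqrD hdot) nrmN nrmZ normc_real ger0_norm ?sqr_ge0 // (dotNr dot).
rewrite (dotZr dot) conjc_real dot_BA_self -rmorphM -rmorphN /=.
have h1 : nrm (B (A y)) <= s * nrm (A y).
  have [z|z] := eqVneq (nrm (B (A y))) 0; first by rewrite z mulr_ge0 ?nrm_ge0.
  have zp : 0 < nrm (B (A y)) by rewrite lt_neqAle eq_sym z nrm_ge0.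
  rewrite -(ler_pM2r zp) -expr2.
  have h2 := homogeneous_bound hs (perp_BA hE hy).
  have e : nrm (B (A y)) ^+ 2 = complex.Re (dot (A y) (A (B (A y)))).
    by rewrite -dot_adjointl (dot_self hdot).
  rewrite e; apply: le_trans (ler_norm _) _; apply: le_trans (normc_Re _) _.
  apply: le_trans (cauchy_schwarz hdot _ _) _.
  rewrite [leRHS]mulrAC mulrC; apply: ler_wpM2r => //; exact: nrm_ge0.
have h3 : nrm (B (A y)) ^+ 2 <= s ^+ 2 * nrm (A y) ^+ 2.
  by rewrite -exprMn lerXn2r ?nnegrE ?mulr_ge0 ?nrm_ge0.
have h4 : (s ^+ 2 * nrm y) ^+ 2 <= s ^+ 2 * s ^+ 2.
  rewrite exprMn -expr2 ler_piMr ?sqr_ge0 //.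
  by apply: exprn_ile1 => //; exact: nrm_ge0.
have h5 : nrm (A y) ^+ 2 <= s ^+ 2 by rewrite lerXn2r ?nnegrE ?nrm_ge0 // hs.
have := ler_wpM2l (sqr_ge0 s) h5; move: h3 h4; lra.
Qed.

Lemma extremal_eigen E x : eigenfamily E -> extremal E x ->
  B (A x) = (nrm (A x) ^+ 2)%:C *: x.
Proof.
move=> hE [hx x1 hmax].
have := BA_defect hE hmax hx x1; rewrite subrr mulr0 => h.
apply/eqP; rewrite -subr_eq0; apply/eqP/nrm_eq0/eqP.
by rewrite -sqrf_eq0 eq_le h sqr_ge0.
Qed.

(** Let s be the supremum. For a maximizing family u compactness provides a
    cluster point y0 of A u, and by [BA_defect] the vectors u themselves
    approach s^-2 B y0, which is the maximizer. If the complement is trivial,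
    then s = 0 and the maximizer is the vector 0. *)
Lemma exists_extremal E : eigenfamily E -> exists x, extremal E x.
Proof.
move=> hE.
pose V := [set nrm (A y) | y in [set y | perp E y /\ nrm y <= 1]].
have [K K0 hK] := bounded_nrm cA.1.
have [KB KB0 hKB] := bounded_nrm bB.
have p0 : perp E 0 by move=> e _; rewrite (dot0l dot).
have supV : has_sup V.
  split; first by exists (nrm (A 0)), 0 => //; split; rewrite ?nrm0.
  exists K => _ [y [_ y1] <-]; apply: le_trans (hK y) _.
  by rewrite ler_piMr.
pose s := sup V.
have hs y : perp E y -> nrm y <= 1 -> nrm (A y) <= s.
  by move=> hy y1; apply: sup_upper_bound => //; exists y.
have s0 : 0 <= s by apply: le_trans (hs 0 p0 _); rewrite ?nrm_ge0 // nrm0.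
have [s00|sn0] := eqVneq s 0.
  exists 0; split; rewrite ?nrm0 // => y hy y1.
  by apply: le_trans (hs y hy y1) _; rewrite s00 nrm_ge0.
have sp : 0 < s by rewrite lt_neqAle eq_sym sn0.
pose S (e : R) := [set u | [/\ perp E u, nrm u <= 1 & s - e < nrm (A u)]].
have [|||y0 hy0] := @compact_cluster _ H A S cA.
- move=> e e0; have [_ [u [pu u1] <-] hu] := sup_adherent e0 supV.
  by exists u; split.
- by move=> e e' ee u [pu u1 hu]; split => //; apply: le_lt_trans hu; lra.
- by move=> e u [].
pose x := (s ^+ 2)^-1%:C *: B y0.
have s2 : 0 < s ^+ 2 by rewrite exprn_gt0.
have approx d : 0 < d -> exists u, [/\ perp E u, nrm u <= 1, s - d < nrm (A u) & nrm (x - u) < d].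
  move=> d0.
  (* The four constraints are s - e >= 0, e <= d and smallness of the two
     contributions to the distance between u and x. *)
  pose e := Num.min (Num.min d s) (Num.min (s ^+ 2 * d / 4 / (KB + 1))
    ((s ^+ 2 * d / 4) ^+ 2 / (4 * s ^+ 3))).
  have KB1 : 0 < KB + 1 by rewrite ltr_wpDl.
  have sd : 0 < s ^+ 2 * d / 4 by rewrite divr_gt0 ?mulr_gt0.
  have s3 : 0 < 4 * s ^+ 3 by rewrite mulr_gt0 ?exprn_gt0.
  have e0 : 0 < e by rewrite !lt_min d0 sp (divr_gt0 sd KB1) (divr_gt0 (exprn_gt0 2 sd) s3).
  have ed : e <= d by rewrite !ge_min lexx.
  have es : e <= s by rewrite !ge_min lexx orbT.
  have eK : e * (KB + 1) <= s ^+ 2 * d / 4.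
    by rewrite -ler_pdivlMr // !ge_min lexx !orbT.
  have e3 : e * (4 * s ^+ 3) <= (s ^+ 2 * d / 4) ^+ 2.
    by rewrite -ler_pdivlMr // !ge_min lexx !orbT.
  have [u [pu u1 hu] uy] := hy0 e e0.
  exists u; split => //; first by apply: le_lt_trans hu; lra.
  have h1 := BA_defect hE hs pu u1.
  have h2 : nrm (B (A u) - (s ^+ 2)%:C *: u) <= s ^+ 2 * d / 4.
    rewrite -(@ler_pXn2r _ 2) ?nnegrE ?nrm_ge0 ?(ltW sd) //.
    apply: le_trans h1 _; apply: le_trans e3.
    have : (s - e) ^+ 2 <= nrm (A u) ^+ 2.
      by rewrite lerXn2r ?nnegrE ?subr_ge0 ?nrm_ge0 // ltW.
    have : 0 <= e ^+ 2 by exact: sqr_ge0.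
    rewrite sqrrB -mulr_natl => h3 h4.
    have h5 : s ^+ 2 - nrm (A u) ^+ 2 <= 2 * (s * e) by lra.
    apply: le_trans (_ : 2 * s ^+ 2 * (2 * (s * e)) <= _).
      by rewrite ler_wpM2l // mulr_ge0 // ltW.
    by rewrite le_eqVlt; apply/orP; left; apply/eqP; ring.
  have h3 : nrm (B y0 - B (A u)) <= s ^+ 2 * d / 4.
    rewrite -(opB linB); apply: le_trans (hKB _) _; apply: le_trans eK.
    rewrite -nrmN opprB mulrC; apply: ler_pM; rewrite ?nrm_ge0 ?(ltW uy) //.
    by rewrite lerDl.
  have -> : x - u = (s ^+ 2)^-1%:C *: ((B y0 - B (A u)) + (B (A u) - (s ^+ 2)%:C *: u)).
    rewrite addrA subrK scalerBr scalerA -rmorphM /= mulVf ?gt_eqF // scale1r.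
    by [].
  rewrite nrmZ normc_real ger0_norm ?invr_ge0 ?(ltW s2) // mulrC ltr_pdivrMr //.
  apply: le_lt_trans (nrmD _ _) _.
  have : 0 < d * s ^+ 2 by rewrite mulr_gt0.
  move: h2 h3; lra.
have small (r C : R) : (forall d, 0 < d -> r <= C * d) -> r <= 0.
  move=> h; apply/ler_addgt0Pr => e e0; rewrite add0r.
  have C1 : 0 < `|C| + 1 by rewrite ltr_wpDl.
  apply: le_trans (h (e / (`|C| + 1)) _) _; first by rewrite divr_gt0.
  rewrite mulrA ler_pdivrMr // mulrC ler_pM2l //.
  by apply: le_trans (ler_norm _) _; rewrite lerDl.
exists x; split.
- move=> e eE; apply: eq0_normc; apply/eqP; rewrite eq_le normc_ge0 andbT.
  apply: (small _ (nrm e)) => d d0; have [u [pu u1 _ xu]] := approx d d0.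
  have -> : dot x e = dot (x - u) e by rewrite (dotDl dot) (dotNl dot) pu // subr0.
  apply: le_trans (cauchy_schwarz hdot _ _) _.
  by rewrite mulrC ler_wpM2l ?nrm_ge0 // ltW.
- rewrite -subr_le0; apply: (small _ 1) => d d0; have [u [pu u1 _ xu]] := approx d d0.
  rewrite mul1r -(subrK u x); have := nrmD (x - u) u; lra.
move=> y hy y1; apply: le_trans (hs y hy y1) _.
rewrite -subr_le0; apply: (small _ (1 + K)) => d d0.
have [u [pu u1 su xu]] := approx d d0.
have h1 : nrm (A u) <= nrm (A x) + K * d.
  have -> : A u = A x - A (x - u) by rewrite -(opB linA) opprB addrC subrK.
  apply: le_trans (nrmD _ _) _; rewrite nrmN lerD2l; apply: le_trans (hK _) _.
  by rewrite ler_wpM2l // ltW.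
move: su h1; lra.
Qed.

End SingularSystem.

(** * Singular vectors and singular numbers *)

Section SingularVectors.
Variables (R : realType) (H : completeNormedModType R[i]).
Variable dot : {dot H for Num.conj}.
Hypothesis hdot : induces_norm dot.
Variable A : H -> H.
Hypothesis cA : compact_op A.
Local Notation B := (adjoint dot A).
Hypothesis bB : bounded_op B.
Implicit Types x y : H.

Let linA : linear A := cA.1.1.
Let linB : linear B := bB.1.

Definition next_vector (E : seq H) : H := xget 0 [set x | extremal dot A E x].

Fixpoint singular_vectors n : seq H :=
  if n is k.+1 then rcons (singular_vectors k) (next_vector (singular_vectors k)) else [::].

Definition singular_vector n : H := next_vector (singular_vectors n).

Local Notation ev := singular_vector.
Local Notation s := (fun n => nrm (A (singular_vector n))).

Lemma singular_vectorsP n x : reflect (exists2 k, (k < n)%N & x = ev k) (x \in singular_vectors n).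
Proof.
apply: (iffP idP) => [|[k kn ->]].
  elim: n => //= n IH; rewrite mem_rcons inE => /orP[/eqP->|/IH[k kn ->]].
    by exists n.
  by exists k => //; exact: ltnW.
elim: n kn => //= n IH; rewrite ltnS leq_eqVlt mem_rcons inE => /orP[/eqP->|/IH->].
  by rewrite eqxx.
by rewrite orbT.
Qed.

Lemma singular_vector_extremal n : extremal dot A (singular_vectors n) (ev n) /\
  eigenfamily dot A (singular_vectors n).
Proof.
have step k : eigenfamily dot A (singular_vectors k) -> extremal dot A (singular_vectors k) (ev k).
  move=> /(exists_extremal hdot cA bB)[x hx]; rewrite /ev /next_vector.
  by case: xgetP => [y _ //|/(_ x)]; case.
suff h : eigenfamily dot A (singular_vectors n) by split => //; exact: step.
elim: n => [|n IH] e //=; rewrite mem_rcons inE => /orP[/eqP->|/IH //].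
exists (nrm (A (ev n)) ^+ 2)%:C.
exact: (extremal_eigen hdot cA IH (step _ IH)).
Qed.

Lemma singular_vector_eigen n : B (A (ev n)) = (s n ^+ 2)%:C *: ev n.
Proof. by have [h1 h2] := singular_vector_extremal n; exact: (extremal_eigen hdot cA h2). Qed.

Lemma singular_vector_orthogonal i j : i != j -> dot (ev i) (ev j) = 0.
Proof.
have main m n : (m < n)%N -> dot (ev n) (ev m) = 0.
  move=> mn; have [[h _ _] _] := singular_vector_extremal n.
  by apply: h; apply/singular_vectorsP; exists m.
rewrite neq_ltn => /orP[h|/main //].
by rewrite (dotC dot) main // conjc0.
Qed.

Lemma singular_bound n y : (forall k, (k < n)%N -> dot y (ev k) = 0) ->
  nrm (A y) <= s n * nrm y.
Proof.
move=> hy; have [[_ _ h] _] := singular_vector_extremal n.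
by apply: (homogeneous_bound cA h) => e /singular_vectorsP[k kn ->]; exact: hy.
Qed.

Lemma singular_value_decr m n : (m <= n)%N -> s n <= s m.
Proof.
move=> mn; have [[_ _ h] _] := singular_vector_extremal m.
have [[p n1 _] _] := singular_vector_extremal n; apply: h => //.
move=> e /singular_vectorsP[k kn ->]; apply: p; apply/singular_vectorsP.
by exists k => //; exact: leq_trans mn.
Qed.

Lemma singular_vector_unit n : 0 < s n -> nrm (ev n) = 1.
Proof.
move=> sn; have [[_ n1 _] _] := singular_vector_extremal n.
apply/eqP; rewrite eq_le n1 /= -(ler_pM2l sn) mulr1.
apply: singular_bound => k kn; apply: singular_vector_orthogonal.
by rewrite neq_ltn kn orbT.
Qed.

Lemma image_orthogonal i j : i != j -> dot (A (ev i)) (A (ev j)) = 0.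
Proof.
by move=> ij; rewrite (dot_adjointr hdot cA) singular_vector_eigen (dotZr dot)
  singular_vector_orthogonal // mulr0.
Qed.

(** Otherwise the vectors A e_n would be orthogonal with norms bounded below,
    which excludes a cluster point. *)
Lemma singular_value_cvg0 l : 0 < l -> exists n, s n < l.
Proof.
move=> l0; apply: contrapT => hn.
have {}hn n : l <= s n by rewrite leNgt; apply/negP => h; apply: hn; exists n.
(* S e consists of the singular vectors of index at least 1 / e. *)
pose S (e : R) := [set u | exists2 n : nat, 1 <= n%:R * e & u = ev n].
have Sex e : 0 < e -> exists u, S e u.
  move=> e0; exists (ev (Num.trunc e^-1).+1), (Num.trunc e^-1).+1 => //.
  rewrite -ler_pdivrMr // mul1r ltW //.
  have /andP[//] : (Num.trunc e^-1)%:R <= e^-1 < (Num.trunc e^-1).+1%:R.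
  by apply: truncn_itv; rewrite invr_ge0 ltW.
have [||y hy] := @compact_cluster _ H A S cA Sex.
- move=> e e' ee u [n hne ->]; exists n => //; apply: le_trans hne _.
  by rewrite ler_wpM2l.
- move=> e u [n _ ->]; rewrite singular_vector_unit //; exact: lt_le_trans (hn n).
have l2 : 0 < l / 2 by rewrite divr_gt0.
have [_ [n _ ->] hny] := hy _ l2.
have e0 : 0 < Num.min (l / 2) (n.+1%:R^-1) by rewrite lt_min l2 /= invr_gt0 ltr0n.
have [_ [m hm ->]] := hy _ e0; rewrite lt_min => /andP[hmy _].
have nm : (n != m)%N.
  apply/eqP => nm; move: hm; rewrite -nm leNgt => /negP; apply.
  have n1 : (0 : R) < n.+1%:R by [].
  apply: le_lt_trans (_ : n%:R * n.+1%:R^-1 < 1).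
    by rewrite ler_wpM2l // ge_min lexx orbT.
  by rewrite ltr_pdivrMr // mul1r ltr_nat.
have : nrm (A (ev n) - A (ev m)) < l.
  have -> : A (ev n) - A (ev m) = (A (ev n) - y) - (A (ev m) - y) by rewrite opprB addrA subrK.
  by apply: le_lt_trans (nrmD _ _) _; rewrite nrmN; lra.
apply/negP; rewrite -leNgt -(@ler_pXn2r _ 2) ?nnegrE ?nrm_ge0 ?(ltW l0) //.
rewrite (nrm_sqrD hdot) nrmN (dotNr dot) image_orthogonal // oppr0 mulr0 addr0.
have h : l ^+ 2 <= s n ^+ 2 by rewrite lerXn2r ?nnegrE ?nrm_ge0 // ltW.
by apply: le_trans h _; rewrite lerDl sqr_ge0.
Qed.

(** Some nonzero combination of the first m + 1 singular vectors satisfies the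
    m conditions, and A expands it by the factor s_m at least. *)
Lemma courant_fischer m (v : 'I_m -> H) (t : R) : 0 <= t ->
  (forall x, (forall i, dot x (v i) = 0) -> nrm (A x) <= t * nrm x) -> s m <= t.
Proof.
move=> t0 ht; rewrite leNgt; apply/negP => tm.
have [a a0 aM] := exists_left_kernel (\matrix_(i < m.+1, j < m) dot (ev i) (v j)) (ltnSn m).
pose x := \sum_(i < m.+1) a 0 i *: ev i.
have spos (i : 'I_m.+1) : s m <= s i by apply: singular_value_decr; rewrite -ltnS.
have xv j : dot x (v j) = 0.
  have := congr1 (fun w : 'rV_m => w 0 j) aM; rewrite !mxE => e0.
  rewrite /x (dot_suml dot) -[RHS]e0; apply: eq_bigr => i _.
  by rewrite (dotZl dot) mxE.
have ort (i j : 'I_m.+1) : i != j -> dot (ev i) (ev j) = 0.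
  by move=> ij; apply: singular_vector_orthogonal.
have ortA (i j : 'I_m.+1) : i != j -> dot (A (ev i)) (A (ev j)) = 0.
  by move=> ij; apply: image_orthogonal.
have unit_ (i : 'I_m.+1) : nrm (ev i) = 1.
  by apply: singular_vector_unit; apply: lt_le_trans (spos i); exact: le_lt_trans tm.
have nx : nrm x ^+ 2 = \sum_(i < m.+1) normc (a 0 i) ^+ 2.
  rewrite (pythagoras hdot (fun i => a 0 i) ort).
  by apply: eq_bigr => i _; rewrite unit_ expr1n mulr1.
have nAx : nrm (A x) ^+ 2 = \sum_(i < m.+1) normc (a 0 i) ^+ 2 * s i ^+ 2.
  rewrite -(pythagoras hdot (fun i => a 0 i) ortA) /x (op_sum linA).
  by congr (nrm _ ^+ 2); apply: eq_bigr => i _; rewrite (opZ linA).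
have le1 : s m ^+ 2 * nrm x ^+ 2 <= nrm (A x) ^+ 2.
  rewrite nx nAx mulr_sumr; apply: ler_sum => i _.
  rewrite mulrC ler_wpM2l ?sqr_ge0 // lerXn2r ?nnegrE ?nrm_ge0 //; exact: spos.
have x0 : 0 < nrm x ^+ 2.
  rewrite lt_neqAle sqr_ge0 andbT eq_sym nx; apply: contra a0 => /eqP h.
  apply/eqP/rowP => i; rewrite mxE; apply: eq0_normc; apply/eqP.
  rewrite -sqrf_eq0; apply/eqP.
  by move/psumr_eq0P: h => -> // j _; exact: sqr_ge0.
have le2 : nrm (A x) ^+ 2 <= t ^+ 2 * nrm x ^+ 2.
  by rewrite -exprMn lerXn2r ?nnegrE ?mulr_ge0 ?nrm_ge0 // ht.
have := le_trans le1 le2; rewrite ler_pM2r // leNgt => /negP; apply.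
by rewrite ltrXn2r ?nnegrE ?nrm_ge0.
Qed.

(** The eigenspace is spanned by those singular vectors whose singular value
    is l: if z is an eigenvector orthogonal to them, then it is orthogonal to
    all preceding singular vectors as well, hence |A z| <= s_N |z| < l |z|
    unless z = 0. *)
Lemma eigenspace_has_dim (l : R) (n0 N : nat) : 0 < l -> (n0 <= N)%N ->
  (forall n, (n < n0)%N -> l < s n) -> (forall n, (n0 <= n < N)%N -> s n = l) ->
  s N < l ->
  has_dim (eigenspace_op (B \o A) ((l ^+ 2)%:C)) (N - n0)%N.
Proof.
move=> l0 n0N hlt heq hN.
pose e (i : 'I_(N - n0)) := ev (n0 + i).
have en (i : 'I_(N - n0)) : s (n0 + i)%N = l.
  by apply: heq; rewrite leq_addr /= -ltn_subRL.
have e_unit i : dot (e i) (e i) = 1.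
  by rewrite (dot_self hdot) /e singular_vector_unit ?expr1n // en.
have e_ort i j : i != j -> dot (e i) (e j) = 0.
  move=> ij; apply: singular_vector_orthogonal.
  by rewrite eqn_add2l.
have coef (a : 'I_(N - n0) -> R[i]) j : dot (\sum_i a i *: e i) (e j) = a j.
  rewrite (dot_suml dot) (bigD1 j) //= (dotZl dot) e_unit mulr1 big1 ?addr0 // => i ij.
  by rewrite (dotZl dot) e_ort ?mulr0.
exists e; split.
  by move=> a ha j; rewrite -coef ha (dot0l dot).
apply/seteqP; split=> [x /= hx|_ [a _ <-]]; last first.
  rewrite /eigenspace_op /= (op_sum linA) (op_sum linB) scaler_sumr.
  apply: eq_bigr => i _; rewrite (opZ linA) (opZ linB) singular_vector_eigen.
  by rewrite en !scalerA mulrC.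
pose y := \sum_i dot x (e i) *: e i; exists (fun i => dot x (e i)) => //.
suff : nrm (x - y) = 0 by move/(@nrm_eq0 _ H)/eqP; rewrite subr_eq0 => /eqP.
have hz : B (A (x - y)) = (l ^+ 2)%:C *: (x - y).
  rewrite (opB linA) (opB linB) scalerBr; congr (_ - _); first exact: hx.
  rewrite /y (op_sum linA) (op_sum linB) scaler_sumr.
  apply: eq_bigr => i _; rewrite (opZ linA) (opZ linB) singular_vector_eigen.
  by rewrite en !scalerA mulrC.
have zperp k : (k < N)%N -> dot (x - y) (ev k) = 0.
  move=> kN; case: (ltnP k n0) => kn0.
    have : dot (B (A (x - y))) (ev k) = dot (x - y) (B (A (ev k))) by exact: (dot_BA hdot cA).
    rewrite hz singular_vector_eigen (dotZl dot) (dotZr dot) conjc_real => /eqP.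
    rewrite -subr_eq0 -mulrBl mulf_eq0 -rmorphB => /orP[/eqP h|/eqP //].
    have /eqP := complexI h; rewrite subr_eq0 => /eqP h2.
    have := hlt k kn0; rewrite -(@ltr_pXn2r _ 2) ?nnegrE ?nrm_ge0 ?(ltW l0) //.
    by rewrite h2 ltxx.
  have kk : (k - n0 < N - n0)%N by rewrite ltn_sub2r // (leq_ltn_trans kn0).
  have -> : ev k = e (Ordinal kk) by rewrite /e /= subnKC.
  by rewrite (dotDl dot) (dotNl dot) coef subrr.
have := singular_bound zperp; set z := x - y in hz zperp *.
have Az : nrm (A z) ^+ 2 = (l * nrm z) ^+ 2.
  apply: complexI; rewrite -(dot_BA_self hdot cA) hz (dotZl dot) (dot_self hdot).
  by rewrite -rmorphM exprMn.
have Az' : nrm (A z) = l * nrm z.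
  apply/eqP; rewrite -(@eqrXn2 _ 2) ?nrm_ge0 ?mulr_ge0 ?nrm_ge0 ?(ltW l0) //.
  exact/eqP.
rewrite Az' => hle; apply/eqP; rewrite eq_le nrm_ge0 andbT leNgt; apply/negP => z0.
by move: hle; rewrite ler_pM2r // leNgt hN.
Qed.

Lemma singular_numbers_exist : singular_numbers dot A s.
Proof.
split=> [n|m n|l l0]; [exact: nrm_ge0|exact: singular_value_decr|].
have exN := singular_value_cvg0 l0.
have exn0 : exists n, s n <= l by have [n hn] := exN; exists n; exact: ltW.
have [n0 hn0 minn0] := ex_minnP exn0; have [N hN minN] := ex_minnP exN.
have n0N : (n0 <= N)%N by apply: minn0; exact: ltW.
have lt_n0 n : (n < n0)%N -> l < s n.
  by move=> h; rewrite ltNge; apply/negP => /minn0; rewrite leqNgt h.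
have eq_l n : (n0 <= n < N)%N -> s n = l.
  move=> /andP[h1 h2]; apply/eqP; rewrite eq_le; apply/andP; split.
    by apply: le_trans hn0; exact: singular_value_decr.
  by rewrite leNgt; apply/negP => /minN; rewrite leqNgt h2.
exists (N - n0)%N; split; last exact: eigenspace_has_dim eq_l hN.
have -> : [set n | s n = l] = (addn n0) @` `I_(N - n0).
  apply/seteqP; split=> [n /= hn|_ [k /= kn <-]]; last first.
    by apply: eq_l; rewrite leq_addr /= -ltn_subRL.
  have n0n : (n0 <= n)%N by rewrite leqNgt; apply/negP => /lt_n0; rewrite hn ltxx.
  exists (n - n0)%N; last by rewrite subnKC.
  rewrite /= ltn_sub2r //; last first.
    by rewrite ltnNge; apply/negP => /singular_value_decr; rewrite hn leNgt hN.
  by rewrite (leq_ltn_trans n0n) // ltnNge; apply/negP => /singular_value_decr; rewrite hn leNgt hN.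
by apply: inj_card_eq => i j _ _; exact: addnI.
Qed.

Lemma singular_numbers_unique u : singular_numbers dot A u -> forall n, u n = s n.
Proof.
have [t0 tdecr tmult] := singular_numbers_exist => -[u0 udecr umult].
(* At the first index where the two sequences differ, the larger of the two
   values occurs at least once more in one sequence than in the other. *)
have main (a b : nat -> R) n : (forall n, 0 <= b n) ->
    (forall m n, (m <= n)%N -> b n <= b m) ->
    (forall l, 0 < l -> exists m, ([set n | a n = l] #= `I_m)%card /\
       ([set n | b n = l] #= `I_m)%card) ->
    (forall k, (k < n)%N -> a k = b k) -> a n <= b n.
  move=> b0 bdecr hm hk; rewrite leNgt; apply/negP => ba.
  have [m [ca cb]] := hm (a n) (le_lt_trans (b0 n) ba).
  have sub : [set k | b k = a n] `<=` [set k | a k = a n] `\ n.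
    move=> k /= bk; have kn : (k < n)%N.
      by rewrite ltnNge; apply/negP => /bdecr; rewrite bk leNgt ba.
    by split; [rewrite hk|move=> kn'; rewrite kn' ltnn in kn].
  have fa : finite_set [set k | a k = a n] by exists m.
  have fb : finite_set [set k | b k = a n] by exists m.
  suff : (#|` fset_set [set k | b k = a n]| < #|` fset_set [set k | a k = a n]|)%N.
    by rewrite (card_fset_set ca) (card_fset_set cb) ltnn.
  apply: fproper_ltn_card; rewrite fproperE; apply/andP; split.
    by rewrite -fset_set_sub // => k /sub[].
  apply/negP; rewrite -fset_set_sub // => h.
  by have [_ /=] := sub n (h n erefl).
have mult l : 0 < l -> exists m, ([set n | u n = l] #= `I_m)%card /\
    ([set n | s n = l] #= `I_m)%card.
  move=> l0; have [m [c1 d1]] := umult l l0; have [m' [c2 d2]] := tmult l l0.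
  by exists m; split => //; rewrite (has_dim_inj d1 d2).
move=> n; have [k] := ubnP n; elim: k n => // k IH n; rewrite ltnS => nk.
have hk j : (j < n)%N -> u j = s j by move=> jn; apply: IH; exact: leq_trans nk.
have mult' l : 0 < l -> exists m, ([set n | s n = l] #= `I_m)%card /\
    ([set n | u n = l] #= `I_m)%card.
  by move=> /mult[m [? ?]]; exists m.
apply/eqP; rewrite eq_le; apply/andP; split.
  exact: (main u s n t0 tdecr mult hk).
exact: (main s u n u0 udecr mult' (fun j jn => esym (hk j jn))).
Qed.

End SingularVectors.

(** * Comparison of singular numbers *)

Section Comparison.
Variables (R : realType) (H : completeNormedModType R[i]).
Variable dot : {dot H for Num.conj}.
Hypothesis hdot : induces_norm dot.
Implicit Types (T A D : H -> H) (x y : H).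

Definition im_form T x : R := complex.Im (dot (T x) x).

Lemma im_formZ T (a : R[i]) x : linear T ->
  im_form T (a *: x) = normc a ^+ 2 * im_form T x.
Proof.
move=> linT; rewrite /im_form (opZ linT) (dotZl dot) (dotZr dot) mulrA.
rewrite -sqr_normc normr_normc -rmorphXn.
by case: (dot _ _) => u v /=; ring.
Qed.

Lemma im_form_parallelogram T x y : linear T ->
  im_form T (x + y) + im_form T (x - y) = 2 * im_form T x + 2 * im_form T y.
Proof.
move=> linT; rewrite /im_form (opB linT) (opD linT).
rewrite !(dotDl dot) !(dotDr dot) !(dotNl dot) !(dotNr dot).
case: (dot (T x) x) (dot (T x) y) (dot (T y) x) (dot (T y) y) => [? ?] [? ?] [? ?] [? ?] /=.
ring.
Qed.

Lemma im_form_le T x : im_form T x <= nrm (T x) * nrm x.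
Proof.
apply: le_trans (cauchy_schwarz hdot _ _).
by apply: le_trans (normc_Im _); exact: ler_norm.
Qed.

Lemma polarization D x y : linear D ->
  4%:R * dot (D x) y = dot (D (x + y)) (x + y) - dot (D (x - y)) (x - y)
   + 'i * (dot (D (x + 'i *: y)) (x + 'i *: y) - dot (D (x - 'i *: y)) (x - 'i *: y)).
Proof.
move=> linD; rewrite !(opB linD) !(opD linD) (opZ linD).
rewrite !(dotDl dot) !(dotDr dot) !(dotNl dot) !(dotNr dot) !(dotZl dot) !(dotZr dot).
have -> : conjc 'i = - 'i :> R[i] by apply/eqP; rewrite eq_complex /= oppr0 !eqxx.
have ii : 'i * 'i = -1 :> R[i] by rewrite -expr2 sqr_i.
rewrite !(mulrN, mulNr, mulrBr, mulrDr, mulrA) ii !mulN1r.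
ring.
Qed.

Section Sesquilinear.
Variables (T D : H -> H) (C : R).
Hypotheses (linT : linear T) (linD : linear D) (C0 : 0 <= C).
Hypothesis hD : forall x, normc (dot (D x) x) <= C * im_form T x.

(** Polarization and the parallelogram law for the form of T. *)
Lemma form_bound x y : normc (dot (D x) y) <= C * (im_form T x + im_form T y).
Proof.
have n4 : normc (4%:R : R[i]) = 4 by rewrite -[4%:R](rmorph_nat (real_complex R)) normc_real ger0_norm.
rewrite -(@ler_pM2l _ 4) // -{1}n4 -normcM (polarization _ _ linD).
apply: le_trans (le_normcD _ _) _; rewrite normcM normc_i mul1r.
have h1 := normcB (dot (D (x + y)) (x + y)) (dot (D (x - y)) (x - y)).
have h2 := normcB (dot (D (x + 'i *: y)) (x + 'i *: y)) (dot (D (x - 'i *: y)) (x - 'i *: y)).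
have k1 := lerD (hD (x + y)) (hD (x - y)).
have k2 := lerD (hD (x + 'i *: y)) (hD (x - 'i *: y)).
rewrite -mulrDr (im_form_parallelogram _ _ linT) in k1.
rewrite -mulrDr (im_form_parallelogram _ _ linT) (im_formZ _ _ linT) normc_i in k2.
apply: le_trans (lerD (le_trans h1 k1) (le_trans h2 k2)) _.
by rewrite le_eqVlt; apply/orP; left; apply/eqP; ring.
Qed.

(** [form_bound] is applied to |y| x and |x| y, which have equal norms. *)
Lemma form_bound_mul s x y : im_form T x <= s * nrm x ^+ 2 ->
  im_form T y <= s * nrm y ^+ 2 -> normc (dot (D x) y) <= 2 * C * s * (nrm x * nrm y).
Proof.
move=> hx hy.
have [x0|x0] := eqVneq (nrm x) 0.
  by rewrite (nrm_eq0 x0) (op0 linD) (dot0l dot) normc0 nrm0 mul0r mulr0.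
have [y0|y0] := eqVneq (nrm y) 0.
  by rewrite (nrm_eq0 y0) (dot0r dot) normc0 nrm0 !mulr0.
have xp : 0 < nrm x by rewrite lt_neqAle eq_sym x0 nrm_ge0.
have yp : 0 < nrm y by rewrite lt_neqAle eq_sym y0 nrm_ge0.
have := form_bound ((nrm y)%:C *: x) ((nrm x)%:C *: y).
rewrite (opZ linD) (dotZl dot) (dotZr dot) conjc_real !normcM !(im_formZ _ _ linT) !normc_real.
rewrite (gtr0_norm xp) (gtr0_norm yp) => h.
have h1 : nrm y ^+ 2 * im_form T x <= nrm y ^+ 2 * (s * nrm x ^+ 2).
  by rewrite ler_wpM2l ?sqr_ge0.
have h2 : nrm x ^+ 2 * im_form T y <= nrm x ^+ 2 * (s * nrm y ^+ 2).
  by rewrite ler_wpM2l ?sqr_ge0.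
have h3 := le_trans h (ler_wpM2l C0 (lerD h1 h2)).
rewrite -(ler_pM2l xp) -(ler_pM2l yp).
apply: le_trans (le_trans _ h3) _; rewrite le_eqVlt; apply/orP; left; apply/eqP; ring.
Qed.

(** [form_bound] is applied to t x and D x / t. For t large the term with
    b(D x) is absorbed in the left-hand side |D x|^2. *)
Lemma norm_bound_compact : bounded_op T ->
  exists2 c : R, 0 <= c & forall x, nrm (D x) ^+ 2 <= c * (nrm (T x) * nrm x).
Proof.
move=> bT; have [K K0 hK] := bounded_nrm bT.
pose t := 1 + 2 * C * K.
have CK : 0 <= 2 * C * K by rewrite !mulr_ge0.
have t0 : 0 < t by rewrite ltr_pwDl.
exists (2 * C * t ^+ 2); first by rewrite !mulr_ge0 // ltW.
move=> x; have := form_bound (t%:C *: x) (t^-1%:C *: D x).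
rewrite (opZ linD) (dotZl dot) (dotZr dot) conjc_real !(im_formZ _ _ linT) !normc_real.
rewrite !ger0_norm ?invr_ge0 ?(ltW t0) // mulrA -rmorphM /= divff ?gt_eqF // mul1r.
rewrite (dot_self hdot) normc_real ger0_norm ?sqr_ge0 // => h.
have hb := im_form_le T x.
have hDx : im_form T (D x) <= K * nrm (D x) ^+ 2.
  apply: le_trans (im_form_le _ _) _.
  by rewrite expr2 mulrA ler_wpM2r ?nrm_ge0.
have tt : C * K <= t ^+ 2 / 2.
  have : t <= t ^+ 2 by rewrite expr2 ler_pMr // /t lerDl.
  by rewrite /t => h'; move: h' CK; lra.
have h1 : C * (t^-1 ^+ 2 * im_form T (D x)) <= nrm (D x) ^+ 2 / 2.
  apply: le_trans (_ : C * (t^-1 ^+ 2 * (K * nrm (D x) ^+ 2)) <= _).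
    by rewrite ler_wpM2l // ler_wpM2l // sqr_ge0.
  have -> : C * (t^-1 ^+ 2 * (K * nrm (D x) ^+ 2)) = C * K * (nrm (D x) ^+ 2 / t ^+ 2).
    by field; rewrite gt_eqF.
  apply: le_trans (ler_wpM2r _ tt) _; first by rewrite divr_ge0 ?sqr_ge0.
  by rewrite le_eqVlt; apply/orP; left; apply/eqP; field; rewrite gt_eqF.
have h2 : C * (t ^+ 2 * im_form T x) <= C * (t ^+ 2 * (nrm (T x) * nrm x)).
  by rewrite ler_wpM2l // ler_wpM2l // sqr_ge0.
move: h; rewrite mulrDr => h; move: h1 h2 h; lra.
Qed.

End Sesquilinear.

(** The 2 n conditions on x are orthogonality to the first n singular vectors of
    T and to their images under the adjoint of D = A - T. They force x and D x
    into the subspace where the form of T is bounded by s_n(T). *)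
Lemma singular_value_comparison T A (C : R) (cT : compact_op T) (cA : compact_op A)
    (bT' : bounded_op (adjoint dot T)) (bA' : bounded_op (adjoint dot A)) :
  0 <= C ->
  (forall x, normc (dot (A x - T x) x) <= C * im_form T x) ->
  forall n, nrm (A (singular_vector dot A (n + n))) <=
    (1 + 2 * C) * nrm (T (singular_vector dot T n)).
Proof.
move=> C0 hD n.
have linT := cT.1.1; have linA := cA.1.1.
pose D x := A x - T x.
have linD : linear D.
  by move=> a x y; rewrite /D linA linT scalerBr opprD addrACA.
pose D' x := adjoint dot A x - adjoint dot T x.
have DD' x y : dot (D x) y = dot x (D' y).
  rewrite /D /D' (dotDl dot) (dotDr dot) (dotNl dot) (dotNr dot).
  by rewrite (dot_adjointr hdot cA) (dot_adjointr hdot cT).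
set s := nrm (T _).
have s0 : 0 <= s by exact: nrm_ge0.
(* The first n conditions say that x is orthogonal to the singular vectors of
   T, the last n that D x is. *)
pose v (i : 'I_(n + n)) := match fintype.split i with
  | inl j => singular_vector dot T j | inr j => D' (singular_vector dot T j) end.
apply: (courant_fischer hdot cA bA' (v := v)); first by rewrite mulr_ge0 // addr_ge0 // mulr_ge0.
move=> x hx.
have xT k : (k < n)%N -> dot x (singular_vector dot T k) = 0.
  by move=> kn; have := hx (lshift n (Ordinal kn)); rewrite /v (unsplitK (inl _)).
have DxT k : (k < n)%N -> dot (D x) (singular_vector dot T k) = 0.
  by move=> kn; have := hx (rshift n (Ordinal kn)); rewrite /v (unsplitK (inr _)) DD'.
have form z : (forall k, (k < n)%N -> dot z (singular_vector dot T k) = 0) ->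
    im_form T z <= s * nrm z ^+ 2.
  move=> hz; apply: le_trans (im_form_le _ _) _.
  rewrite expr2 mulrA ler_wpM2r ?nrm_ge0 //.
  exact: (singular_bound hdot cT bT').
have h1 := form_bound_mul linT linD C0 hD (form x xT) (form (D x) DxT).
have h2 : nrm (D x) <= 2 * C * s * nrm x.
  have [z|z] := eqVneq (nrm (D x)) 0.
    by rewrite z !mulr_ge0 ?nrm_ge0.
  have zp : 0 < nrm (D x) by rewrite lt_neqAle eq_sym z nrm_ge0.
  rewrite -(ler_pM2r zp) -expr2 -[leRHS]mulrA; apply: le_trans h1.
  by rewrite (dot_self hdot) normc_real ger0_norm ?sqr_ge0.
have -> : A x = T x + D x by rewrite /D addrC subrK.
apply: le_trans (nrmD _ _) _.
have := singular_bound hdot cT bT' xT; rewrite -/s; move: h2; lra.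
Qed.

End Comparison.

Section Summability.
Variable R : realType.

(** The terms of index 2 n and 2 n + 1 of the second series are both at most
    c^r s_n^r. *)
Lemma doubled_index_summable (s t : nat -> R) (c r : R) : 0 < r -> 0 <= c ->
  (forall n, 0 <= s n) -> (forall n, 0 <= t n) ->
  (forall m n, (m <= n)%N -> t n <= t m) ->
  (forall n, t (n + n)%N <= c * s n) ->
  cvgn (series (fun n => s n `^ r)) -> cvgn (series (fun n => t n `^ r)).
Proof.
move=> r0 c0 s0 t0 tdecr ts cs.
have [M hM] : exists M, forall n, series (fun n => s n `^ r) n <= M.
  exists (limn (series (fun n => s n `^ r))) => n; apply: nondecreasing_cvgn_le => //.
  by apply: nondecreasing_series => k _ _; exact: powR_ge0.
have cr0 : 0 <= c `^ r by exact: powR_ge0.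
have term n : t (n + n)%N `^ r <= c `^ r * s n `^ r.
  by rewrite -powRM //; apply: ge0_ler_powR; rewrite ?nnegrE ?mulr_ge0 ?(ltW r0).
have even n : series (fun n => t n `^ r) (n + n)%N <= 2 * (c `^ r * series (fun n => s n `^ r) n).
  elim: n => [|n IH]; first by rewrite addn0 /series /= !big_nil !mulr0.
  rewrite addnS addSn.
  rewrite [X in X <= _]/series /= !big_nat_recr //= -/(series _ _).
  rewrite [X in _ * (_ * X)]/series /= big_nat_recr //= -/(series _ _).
  have h1 : t (n + n).+1 `^ r <= t (n + n)%N `^ r.
    by apply: ge0_ler_powR; rewrite ?nnegrE ?(ltW r0) //; exact: tdecr.
  have h2 := term n; move: IH; rewrite /series /=; move: h1 h2; lra.
apply: nondecreasing_is_cvgn.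
  by apply: nondecreasing_series => k _ _; exact: powR_ge0.
exists (2 * (c `^ r * M)) => _ [n _ <-].
apply: (@le_trans _ _ (series (fun n => t n `^ r) (n + n)%N)).
  apply: nondecreasing_series; last exact: leq_addr.
  by move=> k _ _; exact: powR_ge0.
by apply: le_trans (even n) _; rewrite ler_wpM2l // ler_wpM2l.
Qed.

End Summability.

Section Nevanlinna.
Variables (R : realType) (H : completeNormedModType R[i]).
Variable dot : {dot H for Num.conj}.
Hypothesis hdot : induces_norm dot.

Lemma op_derivable_cdiff (F : R[i] -> H -> H) z x : op_derivable_at F z ->
  exists D, cdiff (fun w => dot (F w x) x) z D.
Proof.
move=> [D _ hD]; exists (dot (D x) x) => e e0.
have c0 : 0 < nrm x ^+ 2 + 1 by rewrite ltr_wpDl ?sqr_ge0.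
have [d d0 hd] := hD _ (divr_gt0 e0 c0).
exists d => // h hh; have [->|h0] := eqVneq h 0.
  by rewrite addr0 mulr0 subrr subr0 normc0 mulr0.
have -> : dot (F (z + h) x) x - dot (F z x) x - dot (D x) x * h =
   h * dot (h^-1 *: (F (z + h) x - F z x) - D x) x.
  rewrite [dot (_ - D x) x](dotDl dot) (dotZl dot) !(dotDl dot) !(dotNl dot).
  by field.
rewrite normcM [leRHS]mulrC ler_wpM2l ?normc_ge0 //.
apply: le_trans (cauchy_schwarz hdot _ _) _.
have hlt : `|h| < d%:C by rewrite normr_normc ltcR.
have := hd h h0 hlt x; rewrite !nrmE -rmorphM lecR => hle.
apply: le_trans (ler_wpM2r (nrm_ge0 _) hle) _.
rewrite -mulrA -expr2 mulrAC ler_pdivrMr // ler_pM2l //.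
by rewrite lerDl.
Qed.

(** The form of the imaginary part of T is the imaginary part of the form of
    T. *)
Lemma im_op_im_form (T : H -> H) x : bounded_op T ->
  nonneg_op dot (im_op dot T) -> 0 <= im_form dot T x.
Proof.
move=> bT /(_ x); rewrite /im_op (dotZl dot) (dotDl dot) (dotNl dot).
have -> : dot (adjoint dot T x) x = conjc (dot (T x) x).
  by rewrite (adjointP hdot bT) -(dotC dot).
rewrite subcJ -/(im_form dot T x).
have -> : (2%:R * 'i)^-1 * (2%:R * (im_form dot T x)%:C * 'i) = (im_form dot T x)%:C :> R[i].
  have i0 : 'i != 0 :> R[i] by rewrite eq_complex /= oner_eq0 andbF.
  by field; rewrite i0.
by rewrite ler0c.
Qed.

End Nevanlinna.

Theorem proposition4p16 (R : realType) (H : completeNormedModType R[i])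
    (dot : {dot H for Num.conj}) (hdot : induces_norm dot)
    (hsep : separable_space H)
    (F : R[i] -> H -> H) (hF : nevanlinna dot F)
    (p : \bar R) (hp : (0 < p)%E)
    (z0 : R[i]) (hz0 : 0 < complex.Im z0) (hFz0 : schatten dot p (F z0))
    (z : R[i]) (hz : 0 < complex.Im z) :
  schatten dot p (F z).
Proof.
have [bF dF posF _ adjF] := hF.
have upper (w : R[i]) : 0 < complex.Im w -> off_real w by move=> w0; rewrite /off_real gt_eqF.
have bF' (w : R[i]) : 0 < complex.Im w -> bounded_op (adjoint dot (F w)).
  move=> w0; rewrite adjF; last exact: upper.
  by apply: bF; rewrite /off_real; case: w w0 => a b /= b0; rewrite oppr_eq0 gt_eqF.
have [C C0 hC] := harnack hz hz0.
have [cT hT] := hFz0.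
have hD x : normc (dot (F z x - F z0 x) x) <= C * im_form dot (F z0) x.
  rewrite (dotDl dot) (dotNl dot).
  apply: (hC (fun w => dot (F w x) x)) => w w0.
    by apply: op_derivable_cdiff => //; apply: dF; exact: upper.
  by apply: im_op_im_form => //; [apply: bF; exact: upper|exact: posF].
have bT := bF z0 (upper _ hz0); have bA := bF z (upper _ hz).
have linD : linear (fun x => F z x - F z0 x).
  by move=> a x y; rewrite bA.1 bT.1 scalerBr opprD addrACA.
have cA : compact_op (F z).
  have [c c0 hc] := norm_bound_compact hdot bT.1 linD C0 hD bT.
  apply: (compact_transfer cT bA (_ : 0 <= 2 + 2 * c)); first by rewrite addr_ge0 // mulr_ge0.
  move=> x.
  have h1 : nrm (F z x) <= nrm (F z0 x) + nrm (F z x - F z0 x).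
    by rewrite -{1}(subrK (F z0 x) (F z x)) addrC; exact: nrmD.
  have n1 := nrm_ge0 (F z0 x); have n2 := nrm_ge0 (F z x - F z0 x).
  have h2 : nrm (F z x) ^+ 2 <= (nrm (F z0 x) + nrm (F z x - F z0 x)) ^+ 2.
    by rewrite lerXn2r ?nnegrE ?addr_ge0 ?nrm_ge0.
  have h3 := sqr_ge0 (nrm (F z0 x) - nrm (F z x - F z0 x)).
  have h4 := hc x; have h5 : 0 <= c * nrm (F z0 x) ^+ 2 by rewrite mulr_ge0 ?sqr_ge0.
  have h6 : 0 <= nrm (F z0 x) * nrm x by rewrite mulr_ge0 ?nrm_ge0.
  have arith (a t d td tu ct ctu : R) : a <= t + td + d -> 0 <= t - td + d -> d <= ctu ->
    0 <= ct -> 0 <= tu -> a <= 2 * t + 2 * tu + (2 * ct + 2 * ctu) by lra.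
  rewrite sqrrD in h2; rewrite sqrrB in h3.
  have -> : (2 + 2 * c) * (nrm (F z0 x) ^+ 2 + nrm (F z0 x) * nrm x) =
    2 * nrm (F z0 x) ^+ 2 + 2 * (nrm (F z0 x) * nrm x) +
    (2 * (c * nrm (F z0 x) ^+ 2) + 2 * (c * (nrm (F z0 x) * nrm x))) by ring.
  exact: arith h2 h3 h4 h5 h6.
split=> //; case: p hp hT {hFz0} => // r; rewrite lte_fin => r0 [s [hs cs]].
exists (fun n => nrm (F z (singular_vector dot (F z) n))); split.
  exact: (singular_numbers_exist hdot cA (bF' z hz)).
have sE := singular_numbers_unique hdot cT (bF' z0 hz0) hs.
apply: (doubled_index_summable r0 (_ : 0 <= 1 + 2 * C) _ _ _ _ cs).
- by rewrite addr_ge0 // mulr_ge0.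
- by have [] := hs.
- by move=> n; exact: nrm_ge0.
- by move=> m n; exact: (singular_value_decr hdot cA (bF' z hz)).
move=> n; rewrite sE.
exact: (singular_value_comparison hdot cT cA (bF' z0 hz0) (bF' z hz) C0 hD).
Qed.
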